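(* Suppose that the following hold. (1) The sequences $\{e_{i,t},-\infty<t<\infty\}$, $1\le i\le N$, are independent of each other, and the sequences $\{\eta_t,-\infty<t<\infty\}$ and $\{e_{i,t},-\infty<t<\infty\}$, $1\le i\le N$, are stationary. (2) $t_0=\lfloor T\theta\rfloor$ with some $0<\theta<1$. (3) There exist $\sigma_i$, $1\le i\le N$, and constants $0<C_1\le C_2<\infty$ with $C_1\le\sigma_i\le C_2$ for all $1\le i\le N$, such that $\max_{1\le i\le N}\sup_{1\le t\le T}\left|\frac1t U_{i,2}(t)-\sigma_i^2\right|=o(1)$; and, with some $\kappa>4$, $\frac1N\sup_{1\le t\le T}\sum_{i=1}^N\left(\frac{1}{t^{\kappa/2}}U_{i,\kappa}(t)\right)^2=O(1)$. (4) With some $\bar\kappa>2$: $E\eta_t=0$, $E\left(\sum_{s=1}^t\eta_s\right)^2=t+o(t)$ and $E\left|\sum_{s=1}^t\eta_s\right|^{\bar\kappa}=O(t^{\bar\kappa/2})$ as $t\to\infty$. (5) $\frac{T\Delta_{N,T}}{N}\to\infty$ and $\frac{\Gamma_{N,T}}{(T\Delta_{N,T})^{1/2}}\to0$. (6) $\Delta_{N,T}\to\infty$ and $\frac{\Sigma_{N,T}}{\Delta_{N,T}}=o(1)$. Then $P\{\hat t_{N,T}=t_0\}\to1$.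
   Context: All limits, $o(\cdot)$ and $O(\cdot)$ are taken as $\min(N,T)\to\infty$ unless stated otherwise. The panel data model is $$X_{i,t}=\mu_i+\delta_iI\{t>t_0\}+\gamma_i\eta_t+e_{i,t},\quad 1\le i\le N,\ 1\le t\le T,$$ where $\mu_i,\delta_i,\gamma_i\in\mathbb R$, the errors $e_{i,t}$ have mean zero, $\eta_t$ is a real-valued common factor with loadings $\gamma_i$, $\delta_i$ is the change in the mean of panel $i$, and $t_0$ is the common time of change. The numbers $\delta_i,\gamma_i$ may depend on $N$ and $T$. Put $S_i(t)=\sum_{s=1}^tX_{i,s}$ and $$\hat t_{N,T}=\mathrm{argmax}_{1\le t<T}\sum_{i=1}^N\left(S_i(t)-\frac tTS_i(T)\right)^2.$$ Further, $U_{i,\nu}(t)=E\left|\sum_{s=1}^te_{i,s}\right|^\nu$, $\Delta_{N,T}=\sum_{i=1}^N\delta_i^2$, $\Gamma_{N,T}=\sum_{i=1}^N\gamma_i^2$ and $\Sigma_{N,T}=\sum_{i=1}^N\delta_i\gamma_i$. *)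

(* Defs.v *)
From HB Require Import structures.
From mathcomp Require Import all_boot all_order all_algebra finmap.
From mathcomp Require Import all_classical all_reals all_analysis.
Import Order.TTheory GRing.Theory Num.Theory.
Import numFieldNormedType.Exports.

Set Implicit Arguments.
Unset Strict Implicit.
Unset Printing Implicit Defensive.

Local Open Scope classical_set_scope.
Local Open Scope ring_scope.

(* Panels, times and sample sizes are natural numbers; panels and observation
   times are numbered from 1, so the values of panel-indexed families at 0 are
   never used. *)

(* The limit min(N, T) -> oo on pairs (N, T): a set belongs to this filter iff
   it contains [n0, oo[ x [n0, oo[ for some n0. *)
Definition min_oo : set_system (nat * nat) := filter_prod \oo \oo.

Section processes.
Context d (Omega : measurableType d) (R : realType) (P : probability Omega R).

(* Strict stationarity. *)
Definition stationary (X : int -> Omega -> R) : Prop :=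
  forall (n : nat) (u : n.-tuple int) (h : int) (A : set (n.-tuple R)),
    measurable A ->
    P [set w | A [tuple X (tnth u j + h) w | j < n]] =
    P [set w | A [tuple X (tnth u j) w | j < n]].

Definition sigma_process (X : int -> Omega -> R) : set (set Omega) :=
  <<s \bigcup_(t in [set: int]) preimage_set_system setT (X t) measurable >>.

(* Mutual independence of the sequences e 1, e 2, ... (as whole sequences). *)
Definition independent_sequences (e : nat -> int -> Omega -> R) : Prop :=
  forall (J : {fset nat}) (B : nat -> set Omega),
    (forall i, i \in J -> (1 <= i)%N /\ sigma_process (e i) (B i)) ->
    P (\bigcap_(i in [set` J]) B i) = (\prod_(i <- J) P (B i))%E.

Definition partial_sum (X : int -> Omega -> R) (t : nat) (w : Omega) : R :=
  \sum_(1 <= s < t.+1) X s%:Z w.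

(* E |X_1 + ... + X_t|^nu, as an extended real (possibly +oo). *)
Definition abs_moment (X : int -> Omega -> R) (nu : R) (t : nat) : \bar R :=
  'E_P[fun w => `|partial_sum X t w| `^ nu].

End processes.

Section panel.
Context (Omega : Type) (R : realType).

Definition panel (mu : nat -> R) (delta gamma : nat -> nat -> nat -> R)
    (eta : int -> Omega -> R) (e : nat -> int -> Omega -> R) (t0 : nat)
    (N T i t : nat) (w : Omega) : R :=
  mu i + delta N T i * (t0 < t)%N%:R + gamma N T i * eta t%:Z w + e i t%:Z w.

Definition cusum (X : nat -> nat -> Omega -> R) (i t : nat) (w : Omega) : R :=
  \sum_(1 <= s < t.+1) X i s w.

Definition cusum_criterion (X : nat -> nat -> Omega -> R) (N T : nat)
    (w : Omega) (t : nat) : R :=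
  \sum_(1 <= i < N.+1) (cusum X i t w - t%:R / T%:R * cusum X i T w) ^+ 2.

Definition is_argmax (T : nat) (f : nat -> R) (t : nat) : Prop :=
  (1 <= t < T)%N /\ (forall s, (1 <= s < T)%N -> f s <= f t).

(* Delta_{N,T} = panel_dot delta delta N T, Gamma_{N,T} = panel_dot gamma gamma
   N T and Sigma_{N,T} = panel_dot delta gamma N T. *)
Definition panel_dot (a b : nat -> nat -> nat -> R) (N T : nat) : R :=
  \sum_(1 <= i < N.+1) a N T i * b N T i.

End panel.

Global Instance min_oo_filter : ProperFilter min_oo.
Proof. exact: filter_prod_proper. Qed.

Lemma min_ooP (A : set (nat * nat)) :
  (\forall NT \near min_oo, A NT) <->
  exists n0, forall N T, (n0 <= minn N T)%N -> A (N, T).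
Proof.
split=> [[[B C] [[n _ nB] [m _ mC]] BCA]|[n nA]].
  exists (maxn n m) => N T; rewrite leq_min !geq_max => /andP[/andP[nN _]].
  by move=> /andP[_ mT]; apply: BCA; split; [exact: nB|exact: mC].
exists ([set k | (n <= k)%N], [set k | (n <= k)%N]).
  by split; exists n.
by move=> [N T] /= [nN nT]; apply: nA; rewrite leq_min nN nT.
Qed.

(* Main.v *)
Require Import Defs.
From HB Require Import structures.
From mathcomp Require Import all_boot all_order all_algebra finmap.
From mathcomp Require Import all_classical all_reals all_analysis.
From mathcomp Require Import measurable_realfun.
From mathcomp Require Import ring lra zify.
Import Order.TTheory GRing.Theory Num.Theory.
Import numFieldNormedType.Exports.

Set Implicit Arguments.
Unset Strict Implicit.
Unset Printing Implicit Defensive.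

Local Open Scope classical_set_scope.
Local Open Scope ring_scope.

(* Write V for the CUSUM criterion, k = |t - t0|, and split the bridge of panel i
   into the bridge of the jump, the bridge H of the factor and the bridge E_i of
   the errors.  The jump lowers V(t) below V(t0) by at least c Delta T k, so it
   suffices to bound every other term of V(t) - V(t0) by k A with one random
   variable A, free of t, such that E A = o(Delta T); Markov's inequality then
   excludes all t <> t0 at once.  Uniformity in t comes from the squares-block
   proof of the strong law, which only uses that the increments over a window of
   length k have second moment O(k).  It applies to the factor, to the errors
   weighted by delta or gamma, and to the centred cross terms
   sum_i E_i(t0) e_{i,s}.  The fluctuation of sum_i (E_i(t) - E_i(t0))^2 has
   variance O(N k^2) by independence of the panels and the fourth moments, so
   there a union bound over t <= T is enough.

   The errors do not depend on N and T, so the o(1) in (3) forces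
   E(e_{i,1} + ... + e_{i,t})^2 = sigma_i^2 t exactly: each panel is white noise,
   and the means of the cross terms are bounded. *)

(** * Expectations and second moments *)

(** Close to t0 the drift is only of order Delta T, and up to T rivals have to be beaten, so
    fluctuations are measured relative to k. Two scales occur. Where an increment enters V linearly,
    its square must be at most k^2 times a variable of bounded mean; where it enters squared, a
    bound by k times a variable is required, and the blocks then cost a factor sqrt T in the mean.
    Nothing is assumed on the joint law of the factor and the errors. Products of random terms are
    therefore split by weighted AM-GM into squares with known means, each weight being the typical
    size of the term it balances. Thus A is a nonnegative combination of simple variables, and its
    mean is computed by linearity. Up to constants, E A is at most T |Sigma| + T sqrt Delta + Gamma
    sqrt T + N. Divided by Delta T, the four terms vanish by Sigma / Delta -> 0, Delta -> oo, Gamma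
    / (T Delta)^(1/2) -> 0 and T Delta / N -> oo. Terms of order sqrt(N T), which come from the
    fourth moments, are absorbed by N + T. *)

Section expectation_toolbox.
Context d (Omega : measurableType d) (R : realType) (P : probability Omega R).
Implicit Types f g : Omega -> R.

Definition integ f := P.-integrable setT (EFin \o f).
(** Real-valued, hence 0 by default when the integral is infinite; [integ] accompanies it wherever
    this would matter. *)
Definition Ex f := Rintegral P setT f.

Lemma integ_meas f : integ f -> measurable_fun setT f.
Proof. by move=> /integrableP[/measurable_EFinP]. Qed.

Lemma integ_cst c : integ (cst c).
Proof. exact: finite_measure_integrable_cst. Qed.

Lemma integD f g : integ f -> integ g -> integ (fun w => f w + g w).
Proof. by move=> fi gi; apply: (integrableD _ fi gi). Qed.

Lemma integZ c f : integ f -> integ (fun w => c * f w).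
Proof. by move=> fi; apply: (integrableZl _ c fi). Qed.

Lemma integ_sum I (r : seq I) (Q : pred I) (F : I -> Omega -> R) :
  (forall i, Q i -> integ (F i)) -> integ (fun w => \sum_(i <- r | Q i) F i w).
Proof.
move=> H; elim: r => [|i r ih].
  rewrite (_ : (fun _ => _) = cst 0); first exact: integ_cst.
  by apply/funext => w; rewrite big_nil.
under [X in integ X]eq_fun do rewrite big_cons.
by case Qi: (Q i) => //; apply: integD => //; exact: H.
Qed.

Lemma integ_le f g : measurable_fun setT f -> (forall w, `|f w| <= g w) ->
  integ g -> integ f.
Proof.
move=> mf fg; apply: le_integrable => //; first exact/measurable_EFinP.
by move=> w _ /=; rewrite lee_fin (le_trans (fg w)) ?ler_norm.
Qed.

Lemma Ex_cst c : Ex (cst c) = c.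
Proof.
by rewrite /Ex /cst Rintegral_cst//=; have /= -> := probability_setT P; rewrite mulr1.
Qed.

Lemma ExD f g : integ f -> integ g -> Ex (fun w => f w + g w) = Ex f + Ex g.
Proof. by move=> fi gi; exact: RintegralD. Qed.

Lemma ExZ c f : integ f -> Ex (fun w => c * f w) = c * Ex f.
Proof. by move=> fi; exact: RintegralZl. Qed.

Lemma Ex_sum I (r : seq I) (Q : pred I) (F : I -> Omega -> R) :
  (forall i, Q i -> integ (F i)) ->
  Ex (fun w => \sum_(i <- r | Q i) F i w) = \sum_(i <- r | Q i) Ex (F i).
Proof.
move=> H; elim: r => [|i r ih].
  rewrite (_ : (fun _ => _) = cst 0) ?Ex_cst ?big_nil//.
  by apply/funext => w; rewrite big_nil.
under [X in Ex X]eq_fun do rewrite big_cons.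
rewrite big_cons; case Qi: (Q i) => //.
by rewrite ExD ?ih//; [exact: H|exact: integ_sum].
Qed.

Lemma Ex_le f g : integ f -> integ g -> (forall w, f w <= g w) -> Ex f <= Ex g.
Proof. by move=> fi gi fg; apply: le_Rintegral. Qed.

Lemma Ex_ge0 f : (forall w, 0 <= f w) -> 0 <= Ex f.
Proof. by move=> f0; apply: Rintegral_ge0. Qed.

Lemma EFin_Ex f : integ f -> (\int[P]_w (f w)%:E = (Ex f)%:E)%E.
Proof. by move=> fi; rewrite /Ex/Rintegral fineK//; exact: integrable_fin_num. Qed.

Definition L2 f := measurable_fun setT f /\ integ (fun w => f w ^+ 2).

Lemma L2_integM f g : L2 f -> L2 g -> integ (fun w => f w * g w).
Proof.
move=> [mf fi] [mg gi]; apply: (integ_le _ _ (integD fi gi)).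
  exact: measurable_funM.
move=> w; rewrite normrM -(real_normK (num_real (f w))).
rewrite -(real_normK (num_real (g w))).
by have := normr_ge0 (f w); have := normr_ge0 (g w); nra.
Qed.

Lemma L2_cst c : L2 (cst c).
Proof. by split=> //; exact: (integ_cst (c ^+ 2)). Qed.

Lemma L2_integ f : L2 f -> integ f.
Proof.
move=> Lf; have := L2_integM Lf (L2_cst 1).
by under [X in integ X -> _]eq_fun do rewrite mulr1.
Qed.

Lemma L2D f g : L2 f -> L2 g -> L2 (fun w => f w + g w).
Proof.
move=> Lf Lg; split; first by apply: measurable_funD; [exact: Lf.1|exact: Lg.1].
under [X in integ X]eq_fun do rewrite sqrrD -mulr_natl.
apply: integD Lg.2; apply: integD Lf.2 _; apply: integZ; exact: L2_integM.
Qed.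

Lemma L2Z c f : L2 f -> L2 (fun w => c * f w).
Proof.
move=> Lf; split; first by apply: measurable_funM => //; exact: Lf.1.
by under [X in integ X]eq_fun do rewrite exprMn; apply: integZ; exact: Lf.2.
Qed.

Lemma L2_sum I (r : seq I) (Q : pred I) (F : I -> Omega -> R) :
  (forall i, Q i -> L2 (F i)) -> L2 (fun w => \sum_(i <- r | Q i) F i w).
Proof.
move=> H; elim: r => [|i r ih].
  rewrite (_ : (fun _ => _) = cst 0); first exact: L2_cst.
  by apply/funext => w; rewrite big_nil.
under [X in L2 X]eq_fun do rewrite big_cons.
by case Qi: (Q i) => //; apply: L2D => //; exact: H.
Qed.

Lemma Ex_sq_sum_orth (N : nat) (Y : nat -> Omega -> R) :
  (forall i, (1 <= i <= N)%N -> L2 (Y i)) ->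
  (forall i j, (1 <= i < j)%N -> (j <= N)%N -> Ex (fun w => Y i w * Y j w) = 0) ->
  Ex (fun w => (\sum_(1 <= i < N.+1) Y i w) ^+ 2)
    = \sum_(1 <= i < N.+1) Ex (fun w => Y i w ^+ 2).
Proof.
elim: N => [|N ih] LY oY.
  rewrite big_geq// (_ : (fun _ => _) = cst 0) ?Ex_cst//.
  by apply/funext => w; rewrite big_geq// expr0n.
have LYN : L2 (Y N.+1) by apply: LY; rewrite leqnn.
pose S w := \sum_(1 <= i < N.+1) Y i w.
have LS : L2 S.
  rewrite /S; under [X in L2 X]eq_fun do rewrite big_nat.
  by apply: L2_sum => i iN; apply: LY; lia.
rewrite [in RHS]big_nat_recr//= -ih; [|by move=> i iN; apply: LY; lia|
  by move=> i j ij jN; apply: oY; lia].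
under [X in Ex X = _]eq_fun => w do
  rewrite big_nat_recr//= -/(S w) sqrrD -mulr_natl.
have LSY := L2_integM LS LYN.
rewrite ExD ?LYN.2//; last by apply: integD; [exact: LS.2|exact: integZ].
rewrite ExD ?ExZ //; [|exact: LS.2|exact: integZ].
suff -> : Ex (fun x => S x * Y N.+1 x) = 0 by rewrite mulr0 addr0.
rewrite /S; under [X in Ex X]eq_fun do rewrite big_nat mulr_suml.
rewrite Ex_sum; last first.
  by move=> i iN; apply: L2_integM => //; apply: LY; lia.
by rewrite big1// => i iN; apply: oY; lia.
Qed.

(** The form in which every random bound is carried: closed under sums, nonnegative multiples and
    domination, so bounds are assembled term by term and Markov's inequality is applied once, at the
    end. *)
Definition mean_le f (c : R) := [/\ forall w, 0 <= f w, integ f & Ex f <= c].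

Lemma mean_leD f g a b : mean_le f a -> mean_le g b ->
  mean_le (fun w => f w + g w) (a + b).
Proof.
move=> [f0 fi fa] [g0 gi gb]; split.
- by move=> w; rewrite addr_ge0.
- exact: integD.
- by rewrite ExD// lerD.
Qed.

Lemma mean_leZ k f a : 0 <= k -> mean_le f a ->
  mean_le (fun w => k * f w) (k * a).
Proof.
move=> k0 [f0 fi fa]; split.
- by move=> w; rewrite mulr_ge0.
- exact: integZ.
- by rewrite ExZ// ler_wpM2l.
Qed.

Lemma mean_le_cst a : 0 <= a -> mean_le (fun=> a) a.
Proof. by move=> a0; split => //; [exact: integ_cst|rewrite Ex_cst]. Qed.

Lemma mean_leW f a b : a <= b -> mean_le f a -> mean_le f b.
Proof. by move=> ab [f0 fi fa]; split => //; exact: le_trans ab. Qed.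

Lemma mean_le_dom f g a : measurable_fun setT f ->
  (forall w, 0 <= f w <= g w) -> mean_le g a -> mean_le f a.
Proof.
move=> mf fg [g0 gi ga]; have fi : integ f.
  by apply: integ_le gi => // w; have /andP[? ?] := fg w; rewrite ger0_norm.
split=> //; first by move=> w; have /andP[] := fg w.
by apply: le_trans ga; apply: Ex_le => // w; have /andP[] := fg w.
Qed.

Lemma mean_le_sum I (r : seq I) (Q : pred I) (F : I -> Omega -> R) (c : I -> R) :
  (forall i, Q i -> mean_le (F i) (c i)) ->
  mean_le (fun w => \sum_(i <- r | Q i) F i w) (\sum_(i <- r | Q i) c i).
Proof.
move=> H; split.
- by move=> w; apply: sumr_ge0 => i /H[].
- by apply: integ_sum => i /H[].
- rewrite Ex_sum; last by move=> i /H[].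
  by apply: ler_sum => i /H[].
Qed.

Lemma mean_le_markov f c a (A : set Omega) : mean_le f c -> 0 < a ->
  measurable A -> (forall w, A w -> a <= f w) -> (P A <= (c / a)%:E)%E.
Proof.
move=> [f0 fi fc] a0 mA Af.
have -> : P A = (\int[P]_w (\1_A w)%:E)%E by rewrite integral_indic// setIT.
apply: (@le_trans _ _ (\int[P]_w (a^-1 * f w)%:E)%E); last first.
  rewrite EFin_Ex ?lee_fin ?ExZ//; last exact: integZ.
  by rewrite mulrC ler_wpM2r// invr_ge0 ltW.
apply: ge0_le_integral => //=.
- by apply/measurable_EFinP; exact: measurable_indic.
- by apply/measurable_EFinP/integ_meas/integZ.
- move=> w _; rewrite lee_fin indicE; case: (boolP (w \in A)) => wA /=.
    by rewrite ler_pdivlMl// mulr1 Af//; exact/set_mem.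
  by rewrite mulr_ge0// invr_ge0 ltW.
Qed.

End expectation_toolbox.

(** * Independence and stationarity *)

Lemma eq_measure_integrable d (T : measurableType d) (R : realType)
    (m1 m2 : {measure set T -> \bar R}) (f : T -> \bar R) :
  (forall A, measurable A -> m1 A = m2 A) ->
  m1.-integrable setT f -> m2.-integrable setT f.
Proof.
move=> m12 /integrableP[mf fi]; apply/integrableP; split=> //.
by rewrite (eq_measure_integral m1)// => A mA _; rewrite m12.
Qed.

Section independence.
Context d (Omega : measurableType d) (R : realType) (P : probability Omega R).

Section product_of_two.
Variables X Y : Omega -> R.
Hypothesis mX : measurable_fun setT X.
Hypothesis mY : measurable_fun setT Y.
Let X' : {RV P >-> R} := HB.pack X (isMeasurableFun.Build _ _ _ _ X mX).
Let Y' : {RV P >-> R} := HB.pack Y (isMeasurableFun.Build _ _ _ _ Y mY).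
Let XY w := (X w, Y w).
Let mXY : measurable_fun setT XY.
Proof. exact/measurable_fun_pairP. Qed.
Let XY' : {RV P >-> (R * R)%type} :=
  HB.pack XY (isMeasurableFun.Build _ _ _ _ XY mXY).

(** The law of the pair agrees with the product of the marginals on rectangles, hence everywhere by
    uniqueness of the product measure; Fubini then splits the integral. *)
Lemma Ex_mul_indep :
  (forall A B : set R, measurable A -> measurable B ->
    P (X @^-1` A `&` Y @^-1` B) = (P (X @^-1` A) * P (Y @^-1` B))%E) ->
  L2 P X -> L2 P Y -> Ex P (fun w => X w * Y w) = Ex P X * Ex P Y.
Proof.
move=> ind LX LY.
have iX := L2_integ LX; have iY := L2_integ LY; have iXY := L2_integM LX LY.
pose f (z : R * R) : \bar R := (z.1 * z.2)%:E.
have mf : measurable_fun setT f.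
  by apply/measurable_EFinP; apply: measurable_funM.
have ifp : (distribution P XY').-integrable setT f by exact: integrable_pushforward.
have eqm A : measurable A ->
    distribution P XY' A = (distribution P X' \x distribution P Y')%E A.
  by move=> mA; apply/esym; apply: product_measure_unique => // B C mB mC; exact: ind.
have ifm : (distribution P X' \x distribution P Y')%E.-integrable setT f.
  apply: eq_measure_integrable ifp; exact: eqm.
have E1 : (\int[P]_w (X w * Y w)%:E = \int[distribution P XY']_z f z)%E.
  by rewrite integral_distribution.
have E2 : (\int[distribution P XY']_z f z =
    \int[distribution P X' \x distribution P Y']_z f z)%E.
  by apply: eq_measure_integral => A mA _; exact: eqm.
apply: EFin_inj; rewrite -EFin_Ex// E1 E2 -integral12_prod_meas1//.
have EX : (\int[distribution P X']_x x%:E = (Ex P X)%:E)%E.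
  by rewrite integral_distribution//= EFin_Ex.
have EY : (\int[distribution P Y']_x x%:E = (Ex P Y)%:E)%E.
  by rewrite integral_distribution//= EFin_Ex.
have iX' : (distribution P X').-integrable setT EFin.
  exact: integrable_pushforward.
have iY' : (distribution P Y').-integrable setT EFin.
  exact: integrable_pushforward.
transitivity (\int[distribution P X']_x ((Ex P Y)%:E * x%:E))%E.
  apply: eq_integral => x _.
  transitivity (\int[distribution P Y']_y (x%:E * y%:E))%E.
    by apply: eq_integral => y _.
  by rewrite integralZl// EY muleC.
by rewrite integralZl// EX -EFinM mulrC.
Qed.
End product_of_two.
End independence.

Section adapted.
Context d (Omega : measurableType d) (R : realType) (P : probability Omega R).

(** Stated as measurability on the type carrying the sigma-algebra generated by the whole sequence,
    so that the closure lemmas for measurable functions apply to it directly. *)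
Definition adapted (X : int -> Omega -> R) (Y : Omega -> R) : Prop :=
  measurable_fun [set: g_sigma_algebraType
    (\bigcup_(t in [set: int]) preimage_set_system setT (X t) measurable)] Y.

Lemma adapted_coord X t : adapted X (X t).
Proof.
move=> _ B mB; apply: sub_sigma_algebra; exists t => //.
by exists B.
Qed.

(** The independence assumption, applied to the index set {i, j} with the preimages under [Yi] and
    [Yj] as events, gives the product rule on rectangles. *)
Lemma Ex_mul_panels (e : nat -> int -> Omega -> R) i j (Yi Yj : Omega -> R) :
  (forall i t, measurable_fun setT (e i t)) -> independent_sequences P e ->
  (1 <= i < j)%N -> adapted (e i) Yi -> adapted (e j) Yj -> L2 P Yi -> L2 P Yj ->
  Ex P (fun w => Yi w * Yj w) = Ex P Yi * Ex P Yj.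
Proof.
move=> me ind ij ai aj Li Lj; apply: Ex_mul_indep => //; [exact: Li.1|exact: Lj.1|].
move=> A B mA mB.
pose C k := if k == i then Yi @^-1` A else Yj @^-1` B.
have ji : (j == i) = false by lia.
have := ind [fset i; j]%fset C _.
rewrite big_fsetU1 ?inE/= 1?eq_sym ?ji// big_seq_fset1 /C eqxx ji => <-.
- by rewrite set_fsetU !set_fset1 bigcap_setU !bigcap_set1 eqxx ji.
- move=> k; rewrite !inE => /orP[]/eqP ->; split; try lia.
  + rewrite eqxx; have := ai measurableT _ mA.
    by rewrite setTI.
  + rewrite ji; have := aj measurableT _ mB.
    by rewrite setTI.
Qed.

End adapted.

Section windows.
Context d (Omega : measurableType d) (R : realType) (P : probability Omega R).
Implicit Types X : int -> Omega -> R.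

(** The start is an integer because sums run backwards from t0 are needed for every length, and
    these reach below time 1. *)
Definition win X (a : int) (k : nat) (w : Omega) : R :=
  \sum_(0 <= j < k) X (a + j%:Z) w.

Lemma partial_sum_win X t w : partial_sum X t w = win X 1 t w.
Proof.
rewrite /partial_sum /win big_add1 /=; apply: eq_bigr => j _.
by congr (X _ w); rewrite -[j.+1]add1n PoszD.
Qed.

Lemma win1 X a w : win X a 1 w = X a w.
Proof. by rewrite /win big_nat1 addr0. Qed.

Lemma win_cat X a m n w : win X a (m + n) w = win X a m w + win X (a + m%:Z) n w.
Proof.
rewrite /win !big_mkord big_split_ord /=; congr (_ + _).
by apply: eq_bigr => j _; rewrite PoszD addrA.
Qed.

Lemma measurable_win X a k : (forall t, measurable_fun setT (X t)) ->
  measurable_fun setT (win X a k).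
Proof. by move=> mX; apply: measurable_sum => j. Qed.

(** Positive and negative parts are compared separately, so the equality of integrals needs no
    integrability; the implication is the same comparison for the absolute value of [psi]. *)
Lemma eq_law_integ (f g : Omega -> R) (psi : R -> R) :
  measurable_fun setT f -> measurable_fun setT g -> measurable_fun setT psi ->
  (forall B, measurable B -> P (f @^-1` B) = P (g @^-1` B)) ->
  (\int[P]_w (psi (f w))%:E = \int[P]_w (psi (g w))%:E)%E /\
  (integ P (psi \o f) -> integ P (psi \o g)).
Proof.
move=> mf mg mpsi fg.
pose f' : {RV P >-> R} := HB.pack f (isMeasurableFun.Build _ _ _ _ f mf).
pose g' : {RV P >-> R} := HB.pack g (isMeasurableFun.Build _ _ _ _ g mg).
have ge0E (h : R -> \bar R) : measurable_fun setT h -> (forall x, 0 <= h x)%E ->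
    (\int[P]_w h (f w) = \int[P]_w h (g w))%E.
  move=> mh h0; have := @ge0_integral_distribution _ _ _ _ _ P f' h mh h0.
  have := @ge0_integral_distribution _ _ _ _ _ P g' h mh h0.
  rewrite /comp /= => <- <-; apply: eq_measure_integral => A mA _; exact: fg.
have mE : measurable_fun setT (EFin \o psi) by exact/measurable_EFinP.
split.
  rewrite integralE [RHS]integralE; congr (_ - _)%E.
    rewrite (funepos_comp (EFin \o psi) f) (funepos_comp (EFin \o psi) g).
    exact: (ge0E _ (measurable_funepos mE) (funepos_ge0 _)).
  rewrite (funeneg_comp (EFin \o psi) f) (funeneg_comp (EFin \o psi) g).
  exact: (ge0E _ (measurable_funeneg mE) (funeneg_ge0 _)).
move=> /integrableP[_ fi]; apply/integrableP; split.
  by apply/measurable_EFinP; exact: measurableT_comp.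
rewrite -(ge0E (fun x => `|(psi x)%:E|)%E)//.
by apply: measurableT_comp.
Qed.

(** A window sum is a measurable function of a k-tuple of coordinates, and the shift by [b - a]
    preserves the law of that tuple. *)
Lemma stationary_win X a b k (psi : R -> R) :
  (forall t, measurable_fun setT (X t)) -> stationary P X ->
  measurable_fun setT psi ->
  (\int[P]_w (psi (win X a k w))%:E = \int[P]_w (psi (win X b k w))%:E)%E /\
  (integ P (fun w => psi (win X a k w)) -> integ P (fun w => psi (win X b k w))).
Proof.
move=> mX sX mpsi; apply: eq_law_integ => //; try exact: measurable_win.
move=> B mB.
pose u : k.-tuple int := [tuple a + (val j)%:Z | j < k].
pose A : set (k.-tuple R) := [set v | B (\sum_(j < k) tnth v j)].
have mA : measurable A.
  have ms : measurable_fun setT (fun v : k.-tuple R => \sum_(j < k) tnth v j).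
    by apply: measurable_sum => j; exact: measurable_tnth.
  by have := ms measurableT B mB; rewrite setTI.
have := sX k u (b - a) A mA.
have -> : [set w | A [tuple X (tnth u j + (b - a)) w | j < k]] = win X b k @^-1` B.
  apply/funext => w; rewrite /A /win /= big_mkord; congr B.
  apply: eq_bigr => j _; rewrite !tnth_mktuple; congr (X _ w); ring.
have -> : [set w | A [tuple X (tnth u j) w | j < k]] = win X a k @^-1` B.
  apply/funext => w; rewrite /A /win /= big_mkord; congr B.
  by apply: eq_bigr => j _; rewrite !tnth_mktuple.
by move=> ->.
Qed.

Lemma stationary_Ex X a b k (psi : R -> R) :
  (forall t, measurable_fun setT (X t)) -> stationary P X ->
  measurable_fun setT psi ->
  Ex P (fun w => psi (win X a k w)) = Ex P (fun w => psi (win X b k w)).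
Proof.
by move=> mX sX mpsi; rewrite /Ex /Rintegral (stationary_win a b k mX sX mpsi).1.
Qed.

End windows.

(** * A maximal inequality from second moments *)

Section block_bound.
Context (R : realType).
Implicit Types d : nat -> R.

(** Cauchy-Schwarz against a constant sequence; [cross] bounds the mixed term that the induction
    step produces. *)
Lemma sqr_sum_le n d :
  (\sum_(0 <= s < n) d s) ^+ 2 <= n%:R * \sum_(0 <= s < n) d s ^+ 2.
Proof.
have cross x m : 2 * (\sum_(0 <= s < m) d s) * x <=
    \sum_(0 <= s < m) d s ^+ 2 + m%:R * x ^+ 2.
  elim: m => [|m ih]; first by rewrite !big_geq// !(mulr0, mul0r, addr0).
  rewrite !big_nat_recr//= -natr1; have := sqr_ge0 (d m - x); nra.
elim: n => [|n ih]; first by rewrite !big_geq// expr0n mulr0.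
rewrite !big_nat_recr//= -natr1.
by have := cross (d n) n; nra.
Qed.

(** The sharper bound 2 - 1/J goes through by induction, since 1/J - 1/(J+1) dominates 1/(J+1)^2.
    The summand [(J == 0)] only keeps the denominator positive at J = 0. *)
Lemma sum_inv_sqr (J : nat) : \sum_(1 <= j < J.+1) (j%:R ^+ 2)^-1 <= 2 :> R.
Proof.
suff: \sum_(1 <= j < J.+1) (j%:R ^+ 2)^-1 <= 2 - (J%:R + (J == 0)%:R)^-1 :> R.
  by move=> h; rewrite (le_trans h)// gerBl invr_ge0 addr_ge0.
elim: J => [|[|J] ih].
- by rewrite big_geq// add0r invr1; lra.
- by rewrite big_nat1 expr1n !invr1 addr0 invr1; lra.
rewrite big_nat_recr//= -lerBrDr (le_trans ih)// !addr0.
have J0 : 0 < J.+1%:R :> R by rewrite ltr0n.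
rewrite -[J.+2%:R]natr1; move: (J.+1%:R) J0 => x x0.
rewrite -subr_ge0.
have -> : 2 - (x + 1)^-1 - (x + 1) ^- 2 - (2 - x^-1) = (x * (x + 1) ^+ 2)^-1.
  by field; rewrite !gt_eqF// ltr_wpDl// ltW.
by rewrite invr_ge0 mulr_ge0 ?sqr_ge0// ltW.
Qed.

Lemma sqrSn j : (j.+1 ^ 2 = j ^ 2 + j.*2.+1)%N.
Proof. by rewrite -addn1 sqrnD muln1; lia. Qed.

Lemma floor_sqrt (n : nat) : exists J, (J ^ 2 <= n < J.+1 ^ 2)%N.
Proof.
elim: n => [|n [J /andP[Jn nJ]]]; first by exists 0%N.
by have [?|?] := ltnP n.+1 (J.+1 ^ 2); [exists J|exists J.+1];
  rewrite ?sqrSn in nJ *; lia.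
Qed.

(** With D_k the partial sums of [d], this bounds D_k^2 for all k in the block j^2 <= k < (j+1)^2 at
    once: D_k is split at j^2, and at most 2j further increments remain, treated by Cauchy-Schwarz;
    4j is 2 times 2j. *)
Definition block_bound d j :=
  2 * (\sum_(0 <= s < j ^ 2) d s) ^+ 2 +
  4 * j%:R * \sum_(0 <= s < j.*2) d (j ^ 2 + s)%N ^+ 2.

Lemma block_boundP d j k : (j ^ 2 <= k < j.+1 ^ 2)%N ->
  (\sum_(0 <= s < k) d s) ^+ 2 <= block_bound d j.
Proof.
move=> /andP[jk kj]; have [m km] : exists m, k = (j ^ 2 + m)%N.
  by exists (k - j ^ 2)%N; rewrite subnKC.
subst k.
have mj : (m <= j.*2)%N by move: kj; rewrite sqrSn; lia.
rewrite /block_bound.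
have -> : \sum_(0 <= s < j ^ 2 + m) d s =
    \sum_(0 <= s < j ^ 2) d s + \sum_(0 <= s < m) d (j ^ 2 + s)%N.
  by rewrite !big_mkord big_split_ord.
set x := \sum_(0 <= s < j ^ 2) _; set y := \sum_(0 <= s < m) _.
set z := \sum_(0 <= s < j.*2) _.
have yz : y ^+ 2 <= 2 * j%:R * z.
  apply: (le_trans (sqr_sum_le m (fun s => d (j ^ 2 + s)%N))).
  apply: ler_pM => //; first by apply: sumr_ge0 => i _; exact: sqr_ge0.
    by rewrite -natrM ler_nat mul2n.
  rewrite /z [leRHS](big_cat_nat (n := m))//= lerDl.
  by apply: sumr_ge0 => i _; exact: sqr_ge0.
by have := sqr_ge0 (x - y); nra.
Qed.

Lemma block_bound_ge0 d j : 0 <= block_bound d j.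
Proof.
by rewrite addr_ge0// mulr_ge0 ?sqr_ge0 ?mulr_ge0 ?ler0n//;
  apply: sumr_ge0 => i _; exact: sqr_ge0.
Qed.

(** In the block j that contains k one has (j^2)^p <= k^p, so the summand of that block suffices;
    adding the other blocks frees the bound from k. *)
Lemma block_bound_max d J k p : (1 <= k < J.+1 ^ 2)%N ->
  (\sum_(0 <= s < k) d s) ^+ 2 <=
  k%:R ^+ p * \sum_(1 <= j < J.+1) ((j%:R ^+ 2) ^+ p)^-1 * block_bound d j.
Proof.
move=> /andP[k1 kJ].
have [j /andP[jk kj]] := floor_sqrt k.
have j1 : (1 <= j)%N by case: j {jk} kj => //; lia.
have jJ : (j <= J)%N.
  by rewrite -ltnS -(@ltn_exp2r _ _ 2)// (leq_ltn_trans jk).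
have B0 := block_bound_ge0 d.
rewrite [X in _ <= _ * X](big_cat_nat (n := j))//= ?leqW//.
rewrite [X in _ <= _ * (_ + X)]big_ltn ?ltnS//.
have jpos : 0 < (j%:R ^+ 2) ^+ p :> R by rewrite !exprn_gt0// ltr0n.
apply: (@le_trans _ _ (k%:R ^+ p * (((j%:R ^+ 2) ^+ p)^-1 * block_bound d j))).
  rewrite mulrA; apply: (@le_trans _ _ (block_bound d j)).
    by apply: block_boundP; rewrite jk.
  rewrite ler_peMl// ler_pdivlMr// mul1r -natrX.
  by rewrite lerXn2r ?nnegrE ?ler0n// ler_nat.
have Sp m n : 0 <= \sum_(m <= i < n) ((i%:R ^+ 2) ^+ p)^-1 * block_bound d i.
  apply: sumr_ge0 => i _; apply: mulr_ge0; last exact: B0.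
  by rewrite invr_ge0; do 2 apply: exprn_ge0.
apply: ler_wpM2l; first exact: exprn_ge0.
by rewrite addrCA lerDl addr_ge0.
Qed.

End block_bound.

Section maximal_inequality.
Context d (Omega : measurableType d) (R : realType) (P : probability Omega R).

(** The constant is 10 = 2 + 4 * 2: the head contributes 2 c j^2, the 2j increments weighted by 4j
    contribute 8 c j^2. *)
Lemma mean_le_block_bound (X : nat -> Omega -> R) c j :
  (forall k, mean_le P (fun w => (\sum_(0 <= s < k) X s w) ^+ 2) (c * k%:R)) ->
  (forall s, mean_le P (fun w => X s w ^+ 2) c) ->
  mean_le P (fun w => block_bound (X ^~ w) j) (10 * c * j%:R ^+ 2).
Proof.
move=> HS HX.
have H1 := mean_leZ (ler0n _ 2) (HS (j ^ 2)%N).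
have H2 : mean_le P (fun w => 4 * j%:R * \sum_(0 <= s < j.*2) X (j ^ 2 + s)%N w ^+ 2)
    (4 * j%:R * \sum_(0 <= s < j.*2) c).
  by apply: mean_leZ => //; apply: mean_le_sum => s _; exact: HX.
apply: mean_leW (mean_leD H1 H2).
rewrite sumr_const_nat subn0 -mul2n -[c *+ _]mulr_natr natrX natrM.
by rewrite le_eqVlt; apply/orP; left; apply/eqP; ring.
Qed.

(* Squares blocks: the classical proof of the strong law under second moments,
   D_k being compared with D_{j^2} for j^2 <= k < (j+1)^2. *)
Lemma maximal_inequality (X : nat -> Omega -> R) c J :
  (forall k, mean_le P (fun w => (\sum_(0 <= s < k) X s w) ^+ 2) (c * k%:R)) ->
  (forall s, mean_le P (fun w => X s w ^+ 2) c) ->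
  exists A1 A2 : Omega -> R,
    [/\ mean_le P A1 (10 * c * J%:R), mean_le P A2 (20 * c) &
     forall k w, (1 <= k < J.+1 ^ 2)%N ->
       (\sum_(0 <= s < k) X s w) ^+ 2 <= k%:R * A1 w /\
       (\sum_(0 <= s < k) X s w) ^+ 2 <= k%:R ^+ 2 * A2 w].
Proof.
move=> HS HX.
have c0 : 0 <= c.
  by have [f0 _ fc] := HX 0%N; apply: le_trans fc; exact: Ex_ge0.
(* For p = 1 each block has mean 10 c, whence the growth in J; for p = 2 block j has mean 10 c /
   j^2, which is summable. *)
pose A p w := \sum_(1 <= j < J.+1) ((j%:R ^+ 2) ^+ p)^-1 * block_bound (X ^~ w) j.
have mA p : mean_le P (A p)
    (\sum_(1 <= j < J.+1) ((j%:R ^+ 2) ^+ p)^-1 * (10 * c * j%:R ^+ 2)).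
  apply: mean_le_sum => j _; apply: mean_leZ.
    by rewrite invr_ge0; do 2 apply: exprn_ge0.
  exact: mean_le_block_bound.
exists (A 1%N), (A 2); split.
- apply: mean_leW (mA 1%N).
  rewrite (eq_big_nat _ _ (F2 := fun=> 10 * c)).
    by rewrite sumr_const_nat subn1 /= mulr_natr.
  move=> j /andP[j1 _]; rewrite expr1; field.
  by rewrite pnatr_eq0; lia.
- apply: mean_leW (mA 2).
  rewrite (eq_big_nat _ _ (F2 := fun j => 10 * c * (j%:R ^+ 2)^-1)).
    rewrite -mulr_sumr.
    have := sum_inv_sqr R J; move: (\sum_(1 <= j < J.+1) _) => S; nra.
  move=> j /andP[j1 _]; field.
  by rewrite pnatr_eq0; lia.
- move=> k w kJ; split; last exact: block_bound_max.
  by rewrite -[X in _ <= X * _]expr1; exact: block_bound_max.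
Qed.

End maximal_inequality.

(** * Increments and bridges around the change point *)

Definition gap (s t : nat) : nat := (s - t + (t - s))%N.

(** The CUSUM transform of a path: linear in [f], and zero on multiples of t, which removes the
    panel means. *)
Definition bridge (R : realType) (T : nat) (f : nat -> R) (t : nat) : R :=
  f t - t%:R / T%:R * f T.

Section processes_increments.
Context d (Omega : measurableType d) (R : realType) (P : probability Omega R).

Lemma win_rev (Y : int -> Omega -> R) (t : int) k w :
  \sum_(0 <= s < k) Y (t - s%:Z) w = win Y (t - k%:Z + 1) k w.
Proof.
rewrite /win big_nat_rev /= add0n; apply: eq_big_nat => j jk.
by congr (Y _ w); lia.
Qed.

Lemma win_gap (Y : int -> Omega -> R) s t w :
  (win Y 1 s w - win Y 1 t w) ^+ 2 =
  win Y (1 + (minn s t)%:Z) (gap s t) w ^+ 2.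
Proof.
have H a b : (a <= b)%N -> win Y 1 b w - win Y 1 a w = win Y (1 + a%:Z) (b - a) w.
  by move=> ab; rewrite -[in win Y 1 b w](subnKC ab) win_cat addrC addKr.
have [st|/ltnW ts] := leqP s t; rewrite /gap.
  by rewrite (eqP st) -sqrrN opprB H.
by rewrite (eqP ts) addn0 H.
Qed.

(** The maximal inequality is run forwards and backwards from t0, and the two bounds are added.
    Taking J = floor(sqrt T) makes (J+1)^2 exceed every gap up to T and turns the factor J into sqrt
    T. Only window bounds are assumed, not stationarity, since the lemma must also serve the centred
    cross terms. *)
Lemma process_increments (Y : int -> Omega -> R) c T t0 :
  (forall a k, mean_le P (fun w => win Y a k w ^+ 2) (c * k%:R)) ->
  (t0 <= T)%N ->
  exists A1 A2 : Omega -> R,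
    [/\ mean_le P A1 (20 * c * Num.sqrt T%:R), mean_le P A2 (40 * c) &
     forall t w, (t <= T)%N ->
       (win Y 1 t w - win Y 1 t0 w) ^+ 2 <= (gap t t0)%:R * A1 w /\
       (win Y 1 t w - win Y 1 t0 w) ^+ 2 <= (gap t t0)%:R ^+ 2 * A2 w].
Proof.
move=> HY t0T; have [J /andP[JT TJ]] := floor_sqrt T.
have c0 : 0 <= c.
  have [f0 _ fc] := HY 0 1%N; rewrite -(mulr1 c); apply: le_trans fc.
  exact: Ex_ge0.
have HY1 a : mean_le P (fun w => Y a w ^+ 2) c.
  by have := HY a 1%N; rewrite mulr1; under eq_fun do rewrite win1.
have JsT : J%:R <= Num.sqrt T%:R :> R.
  have := sqrtr_sqr (J%:R : R); rewrite ger0_norm// => <-.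
  by rewrite ler_sqrt ?ler0n// -natrX ler_nat.
have [A1 [A2 [H1 H2 HA]]] := @maximal_inequality _ _ _ P
  (fun s => Y (1 + t0%:Z + s%:Z)) c J (fun k => HY _ k) (fun s => HY1 _).
have HB k : mean_le P (fun w => (\sum_(0 <= s < k) Y (t0%:Z - s%:Z) w) ^+ 2)
    (c * k%:R).
  by under eq_fun do rewrite win_rev; exact: HY.
have [B1 [B2 [H1' H2' HA']]] := @maximal_inequality _ _ _ P
  (fun s => Y (t0%:Z - s%:Z)) c J HB (fun s => HY1 _).
exists (fun w => A1 w + B1 w), (fun w => A2 w + B2 w); split.
- by apply: mean_leW (mean_leD H1 H1'); nra.
- by apply: mean_leW (mean_leD H2 H2'); lra.
move=> t w tT; have [a1 _ _] := H1; have [a2 _ _] := H2.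
have [b1 _ _] := H1'; have [b2 _ _] := H2'.
have g0 : 0 <= (gap t t0)%:R :> R by [].
suff h : (win Y 1 t w - win Y 1 t0 w) ^+ 2 <=
    (gap t t0)%:R * Num.max (A1 w) (B1 w) /\
   (win Y 1 t w - win Y 1 t0 w) ^+ 2 <=
    (gap t t0)%:R ^+ 2 * Num.max (A2 w) (B2 w).
  have [h1 h2] := h; split.
    apply: (le_trans h1); apply: ler_wpM2l => //.
    by rewrite ge_max lerDl lerDr a1 b1.
  apply: (le_trans h2); apply: ler_wpM2l; first exact: exprn_ge0.
  by rewrite ge_max lerDl lerDr a2 b2.
have [t0t|tt0|->] := ltngtP t0 t; last first.
- by rewrite subrr expr0n /gap subnn !(expr0n, mul0r).
- have kJ : (1 <= t0 - t < J.+1 ^ 2)%N by lia.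
  have [E1 E2] := HA' _ w kJ; rewrite win_rev in E1 E2.
  have -> : win Y 1 t w - win Y 1 t0 w =
      - win Y (t0%:Z - (t0 - t)%:Z + 1) (t0 - t) w.
    rewrite -[in win Y 1 t0 w](subnKC (ltnW tt0)) win_cat opprD addrA subrr sub0r.
    by congr (- win Y _ _ _); lia.
  have -> : gap t t0 = (t0 - t)%N by rewrite /gap; lia.
  rewrite sqrrN; split.
    by apply: (le_trans E1); apply: ler_wpM2l => //; rewrite le_max lexx orbT.
  apply: (le_trans E2); apply: ler_wpM2l; first exact: exprn_ge0.
  by rewrite le_max lexx orbT.
- have kJ : (1 <= t - t0 < J.+1 ^ 2)%N by lia.
  have [E1 E2] := HA _ w kJ.
  have -> : win Y 1 t w - win Y 1 t0 w = win Y (1 + t0%:Z) (t - t0) w.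
    by rewrite -[in win Y 1 t w](subnKC (ltnW t0t)) win_cat addrC addKr.
  have -> : gap t t0 = (t - t0)%N by rewrite /gap; lia.
  split.
    by apply: (le_trans E1); apply: ler_wpM2l => //; rewrite le_max lexx.
  apply: (le_trans E2); apply: ler_wpM2l; first exact: exprn_ge0.
  by rewrite le_max lexx.
Qed.

Lemma sqr_gap (s t : nat) : (gap s t)%:R ^+ 2 = (s%:R - t%:R) ^+ 2 :> R.
Proof.
have [st|/ltnW ts] := leqP s t; rewrite /gap.
  by rewrite (eqP st) natrB// -sqrrN opprB.
by rewrite (eqP ts) addn0 natrB.
Qed.

Lemma bridge_diff_sqr (f : nat -> R) T t0 t : (0 < T)%N ->
  (bridge T f t - bridge T f t0) ^+ 2 <=
  2 * (f t - f t0) ^+ 2 + 2 * (gap t t0)%:R ^+ 2 * (f T ^+ 2 / T%:R ^+ 2).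
Proof.
move=> T0; rewrite /bridge sqr_gap.
have T0' : 0 < T%:R :> R by rewrite ltr0n.
rewrite -subr_ge0.
have -> : 2 * (f t - f t0) ^+ 2 +
    2 * (t%:R - t0%:R) ^+ 2 * (f T ^+ 2 / T%:R ^+ 2) -
    (f t - t%:R / T%:R * f T - (f t0 - t0%:R / T%:R * f T)) ^+ 2 =
    (f t - f t0 + (t%:R - t0%:R) * (f T / T%:R)) ^+ 2.
  by field; rewrite gt_eqF.
exact: sqr_ge0.
Qed.

Lemma bridge_sqr (f : nat -> R) T t : (0 < T)%N -> (t <= T)%N ->
  bridge T f t ^+ 2 <= 2 * f t ^+ 2 + 2 * f T ^+ 2.
Proof.
move=> T0 tT; have T0' : 0 < T%:R :> R by rewrite ltr0n.
have x1 : t%:R / T%:R <= 1 :> R by rewrite ler_pdivrMr// mul1r ler_nat.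
have x0 : 0 <= t%:R / T%:R :> R by rewrite divr_ge0.
rewrite /bridge; move: (_ / _) x0 x1 (f t) (f T) => x x0 x1 a b.
have h1 : x ^+ 2 * b ^+ 2 <= b ^+ 2 by rewrite ler_piMl ?sqr_ge0// expr_le1.
by have := sqr_ge0 (a + x * b); nra.
Qed.

(** Passing to bridges adds the endpoint term (gap/T)^2 Y(T)^2, where gap <= T and Y(T)^2 has mean
    at most c T. The constants are 42 = 2 * 20 + 2 and 82 = 2 * 40 + 2. *)
Lemma process_bridge (Y : int -> Omega -> R) c T t0 :
  (forall t, measurable_fun setT (Y t)) ->
  (forall a k, mean_le P (fun w => win Y a k w ^+ 2) (c * k%:R)) ->
  (0 < T)%N -> (t0 <= T)%N ->
  exists A1 A2 : Omega -> R,
    [/\ mean_le P A1 (42 * c * Num.sqrt T%:R), mean_le P A2 (82 * c),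
     mean_le P (fun w => bridge T (fun t => win Y 1 t w) t0 ^+ 2) (4 * c * T%:R) &
     forall t w, (t <= T)%N ->
       (bridge T (fun t => win Y 1 t w) t - bridge T (fun t => win Y 1 t w) t0) ^+ 2
          <= (gap t t0)%:R * A1 w /\
       (bridge T (fun t => win Y 1 t w) t - bridge T (fun t => win Y 1 t w) t0) ^+ 2
          <= (gap t t0)%:R ^+ 2 * A2 w].
Proof.
move=> mY HY T0 t0T; have T0' : 0 < T%:R :> R by rewrite ltr0n.
have T1 : 1 <= T%:R :> R by rewrite ler1n.
have sT1 : 1 <= Num.sqrt T%:R :> R by rewrite -[leLHS]sqrtr1 ler_sqrt.
have c0 : 0 <= c.
  have [f0 _ fc] := HY 0 1%N; rewrite -(mulr1 c); apply: le_trans fc.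
  exact: Ex_ge0.
have [A1 [A2 [H1 H2 HA]]] := process_increments HY t0T.
have HT := HY 1 T.
exists (fun w => 2 * A1 w + 2 / T%:R * win Y 1 T w ^+ 2),
       (fun w => 2 * A2 w + 2 / T%:R ^+ 2 * win Y 1 T w ^+ 2); split.
- have k0 : 0 <= 2 / T%:R :> R by rewrite divr_ge0.
  apply: mean_leW (mean_leD (mean_leZ (ler0n _ 2) H1) (mean_leZ k0 HT)).
  rewrite -subr_ge0.
  have -> : 42 * c * Num.sqrt T%:R - (2 * (20 * c * Num.sqrt T%:R) +
     2 / T%:R * (c * T%:R)) = 2 * c * (Num.sqrt T%:R - 1).
    by field; rewrite gt_eqF.
  by rewrite !mulr_ge0// subr_ge0.
- have k0 : 0 <= 2 / T%:R ^+ 2 :> R by rewrite divr_ge0// exprn_ge0.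
  apply: mean_leW (mean_leD (mean_leZ (ler0n _ 2) H2) (mean_leZ k0 HT)).
  have -> : 2 / T%:R ^+ 2 * (c * T%:R) = 2 * c * (T%:R)^-1.
    by field; rewrite gt_eqF.
  have : (T%:R)^-1 <= 1 :> R by rewrite invf_le1.
  by have : 0 <= (T%:R)^-1 :> R; [rewrite invr_ge0|nra].
- have HA0 : mean_le P (fun w => 2 * win Y 1 t0 w ^+ 2 + 2 * win Y 1 T w ^+ 2)
      (2 * (c * t0%:R) + 2 * (c * T%:R)).
    by apply: mean_leD; apply: mean_leZ.
  have H4 : 2 * (c * t0%:R) + 2 * (c * T%:R) <= 4 * c * T%:R.
    have : t0%:R <= T%:R :> R by rewrite ler_nat.
    nra.
  apply: mean_leW H4 (mean_le_dom _ _ HA0).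
    apply: measurable_funX; apply: measurable_funB; first exact: measurable_win.
    by apply: measurable_funM => //; exact: measurable_win.
  by move=> w; rewrite sqr_ge0 bridge_sqr.
- move=> t w tT; have [E1 E2] := HA t w tT.
  have B := bridge_diff_sqr (fun t => win Y 1 t w) t0 t T0.
  have g0 : 0 <= (gap t t0)%:R :> R by [].
  have gT : (gap t t0)%:R <= T%:R :> R by rewrite ler_nat /gap; lia.
  have wT := sqr_ge0 (win Y 1 T w).
  split; apply: (le_trans B).
    have : (gap t t0)%:R ^+ 2 * (win Y 1 T w ^+ 2 / T%:R ^+ 2) <=
           (gap t t0)%:R * (win Y 1 T w ^+ 2 / T%:R).
      rewrite -subr_ge0.
      have -> : (gap t t0)%:R * (win Y 1 T w ^+ 2 / T%:R) -
         (gap t t0)%:R ^+ 2 * (win Y 1 T w ^+ 2 / T%:R ^+ 2) =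
         (gap t t0)%:R * (win Y 1 T w ^+ 2 / T%:R ^+ 2) * (T%:R - (gap t t0)%:R).
        by field; rewrite gt_eqF.
      apply: mulr_ge0; last by rewrite subr_ge0.
      by apply: mulr_ge0 => //; apply: divr_ge0 => //; exact: exprn_ge0.
    have -> : 2 / T%:R * win Y 1 T w ^+ 2 = 2 * (win Y 1 T w ^+ 2 / T%:R).
      by rewrite mulrAC mulrA.
    nra.
  have -> : 2 / T%:R ^+ 2 * win Y 1 T w ^+ 2 = 2 * (win Y 1 T w ^+ 2 / T%:R ^+ 2).
    by rewrite mulrAC mulrA.
  nra.
Qed.

End processes_increments.

(** * Moments of sums over panels *)

(** AM-GM in the form sqrt A <= (l + A/l)/2: the root becomes linear in A, so that a bound on the
    mean of A is enough. *)
Lemma norm_le_weighted (R : realType) (x k A l : R) : 0 <= k -> 0 <= A -> 0 < l ->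
  x ^+ 2 <= k ^+ 2 * A -> `|x| <= k * ((l + A / l) / 2).
Proof.
move=> k0 A0 l0 xkA; have y0 : 0 <= k * ((l + A / l) / 2).
  by rewrite mulr_ge0// divr_ge0// addr_ge0 ?divr_ge0// ltW.
rewrite -(ger0_norm y0) -ler_sqr ?nnegrE// -!normrX !ger0_norm ?sqr_ge0//.
apply: (le_trans xkA); rewrite [leRHS]exprMn ler_wpM2l ?sqr_ge0//.
rewrite -subr_ge0.
have -> : ((l + A / l) / 2) ^+ 2 - A = ((l - A / l) / 2) ^+ 2.
  by field; rewrite gt_eqF.
exact: sqr_ge0.
Qed.

Lemma gap_lipschitz (R : realType) (f : nat -> R) (S : R) (s t : nat) :
  (forall n, `|f n.+1 - f n| <= S) -> `|f s - f t| <= S * (gap s t)%:R.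
Proof.
move=> fS; have H m n : `|f (m + n)%N - f m| <= S * n%:R.
  elim: n => [|n ih]; first by rewrite addn0 subrr normr0 mulr0.
  rewrite addnS -(subrK (f (m + n)%N) (f (m + n).+1)) -addrA -natr1 mulrDr mulr1.
  by rewrite addrC (le_trans (ler_normD _ _))// lerD.
have [st|/ltnW ts] := leqP s t; rewrite /gap.
  by have := H s (t - s)%N; rewrite (eqP st) add0n subnKC// distrC.
by have := H t (s - t)%N; rewrite (eqP ts) addn0 subnKC.
Qed.

Section panels.
Context d (Omega : measurableType d) (R : realType) (P : probability Omega R).
Variables (e : nat -> int -> Omega -> R) (s2 : nat -> R) (S C4 : R) (N : nat).
Variable u4 : nat -> nat -> R.
Hypothesis me : forall i t, measurable_fun setT (e i t).
Hypothesis e_indep : independent_sequences P e.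
Hypothesis e_mean : forall i t, (1 <= i)%N -> Ex P (e i t) = 0.
Hypothesis e_var : forall i a k, (1 <= i)%N ->
  Ex P (fun w => win (e i) a k w ^+ 2) = s2 i * k%:R.
Hypothesis s2_le : forall i, (1 <= i)%N -> 0 <= s2 i <= S.
Hypothesis e_L4 : forall i a k, (1 <= i)%N ->
  L2 P (fun w => win (e i) a k w ^+ 2).
Hypothesis e_u4 : forall i a k, (1 <= i)%N ->
  Ex P (fun w => win (e i) a k w ^+ 4) = u4 i k.
(** Fourth moments are controlled only in the sum over the panels, which is the form that the
    averaged moment assumption yields. *)
Hypothesis u4_le : forall k, \sum_(1 <= i < N.+1) u4 i k <= C4 * N%:R * k%:R ^+ 2.

(** Centred functions of different panels are orthogonal, so variances add; each variance is at most
    the raw second moment. *)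
Lemma panel_sum_centered (Y : nat -> Omega -> R) :
  (forall i, (1 <= i)%N -> adapted (e i) (Y i)) ->
  (forall i, (1 <= i)%N -> L2 P (Y i)) ->
  mean_le P (fun w => (\sum_(1 <= i < N.+1) (Y i w - Ex P (Y i))) ^+ 2)
    (\sum_(1 <= i < N.+1) Ex P (fun w => Y i w ^+ 2)).
Proof.
move=> aY LY.
pose Z i w := Y i w + - Ex P (Y i).
have LZ i : (1 <= i)%N -> L2 P (Z i).
  by move=> i1; apply: L2D; [exact: LY|exact: (L2_cst P (- Ex P (Y i)))].
have aZ i : (1 <= i)%N -> adapted (e i) (Z i).
  by move=> i1; apply: measurable_funD; [exact: aY|exact: measurable_cst].
have EZ i : (1 <= i)%N -> Ex P (Z i) = 0.
  move=> i1; rewrite /Z ExD ?Ex_cst ?subrr//; last exact: integ_cst.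
  exact/L2_integ/LY.
have LS : L2 P (fun w => \sum_(1 <= i < N.+1) Z i w).
  under [X in L2 P X]eq_fun do rewrite big_nat.
  by apply: L2_sum => i /andP[i1 _]; exact: LZ.
split; [by move=> w; exact: sqr_ge0|exact: LS.2|].
rewrite Ex_sq_sum_orth; last 2 first.
- by move=> i /andP[i1 _]; exact: LZ.
- move=> i j ij jN; rewrite (Ex_mul_panels (e := e) (i := i) (j := j))//.
  + by rewrite EZ ?mul0r//; lia.
  + by apply: aZ; lia.
  + by apply: aZ; lia.
  + by apply: LZ; lia.
  + by apply: LZ; lia.
apply: ler_sum_nat => i /andP[i1 _].
have iY := L2_integ (LY i i1).
have -> : (fun w => Z i w ^+ 2) =
    (fun w => Y i w ^+ 2 + ((- 2 * Ex P (Y i)) * Y i w + Ex P (Y i) ^+ 2)).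
  by apply/funext => w; rewrite /Z; ring.
rewrite ExD; [|exact: (LY i i1).2|apply: integD; [exact: integZ|exact: integ_cst]].
rewrite ExD; [|exact: integZ|exact: integ_cst].
rewrite ExZ// Ex_cst.
by have := sqr_ge0 (Ex P (Y i)); nra.
Qed.

Lemma adapted_win i a k : adapted (e i) (win (e i) a k).
Proof. by apply: measurable_sum => j; exact: adapted_coord. Qed.

Lemma L2_win i a k : (1 <= i)%N -> L2 P (win (e i) a k).
Proof.
move=> i1; split; first by apply: measurable_win => t.
exact: L2_integ (e_L4 a k i1).
Qed.

Lemma L2_e i t : (1 <= i)%N -> L2 P (e i t).
Proof.
move=> i1; have := L2_win t 1 i1; rewrite (_ : win _ _ _ = e i t)//.
by apply/funext => w; rewrite win1.
Qed.

Lemma Ex_win i a k : (1 <= i)%N -> Ex P (win (e i) a k) = 0.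
Proof.
move=> i1; rewrite /win Ex_sum; last by move=> j _; exact/L2_integ/L2_e.
by rewrite big1// => j _; exact: e_mean.
Qed.

(* As the second moments of the windows are exactly linear in their length,
   the noise is white: [2xy = (x+m+y)^2 - (x+m)^2 - (m+y)^2 + m^2]. *)
Lemma white_noise i (a : int) (m : nat) : (1 <= i)%N ->
  Ex P (fun w => e i a w * e i (a + 1 + m%:Z) w) = 0.
Proof.
move=> i1.
have LL a' k' := L2_win a' k' i1.
have iV a' k' : integ P (fun w => win (e i) a' k' w ^+ 2) by exact: (LL a' k').2.
have H : (fun w => 2 * (e i a w * e i (a + 1 + m%:Z) w)) =
  (fun w => (win (e i) a (1 + (m + 1)) w ^+ 2 + (-1) * win (e i) a (1 + m) w ^+ 2) +
    ((-1) * win (e i) (a + 1) (m + 1) w ^+ 2 + win (e i) (a + 1) m w ^+ 2)).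
  apply/funext => w; rewrite !win_cat !win1; ring.
have : Ex P (fun w => 2 * (e i a w * e i (a + 1 + m%:Z) w)) = 0.
  rewrite H !ExD ?ExZ ?e_var//; try by repeat (apply: integD || apply: integZ).
  by rewrite !natrD; ring.
rewrite ExZ; last by apply: L2_integM; exact: L2_e.
by move=> /eqP; rewrite mulf_eq0 pnatr_eq0 => /eqP.
Qed.

Lemma Ex_cross i (t r : int) : (1 <= i)%N ->
  Ex P (fun w => e i t w * e i r w) = if t == r then s2 i else 0.
Proof.
move=> i1; case: (ltgtP t r) => [tr|rt|->].
- have -> : r = t + 1 + (absz (r - t - 1)%R)%:Z by lia.
  exact: white_noise.
- have -> : t = r + 1 + (absz (t - r - 1)%R)%:Z by lia.
  rewrite -[RHS](white_noise r (absz (t - r - 1)%R) i1).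
  by congr (Ex P _); apply/funext => w; rewrite mulrC.
- rewrite -[RHS]mulr1 -(e_var r 1 i1); congr (Ex P _); apply/funext => w.
  by rewrite win1.
Qed.

(** By whiteness at most one time of the window, r itself, contributes. *)
Lemma Ex_win_cross i n (r : int) : (1 <= i)%N ->
  0 <= Ex P (fun w => win (e i) 1 n w * e i r w) <= s2 i.
Proof.
move=> i1.
suff -> : Ex P (fun w => win (e i) 1 n w * e i r w) =
    if (1 <= r <= n%:Z) then s2 i else 0.
  by have /andP[? _] := s2_le i1; case: ifP; rewrite ?lexx ?andbT.
rewrite /win; under [X in Ex P X]eq_fun do rewrite mulr_suml.
rewrite Ex_sum; last by move=> j _; apply: L2_integM; exact: L2_e.
under eq_bigr do rewrite Ex_cross//.
elim: n => [|n ih]; first by rewrite big_geq//; case: ifP => //; lia.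
rewrite big_nat_recr//= ih.
case: ifP => h1; case: ifP => h2; case: ifP => h3; rewrite ?addr0 ?add0r//; lia.
Qed.

Lemma eq_mean_le (f g : Omega -> R) c : f =1 g -> mean_le P f c -> mean_le P g c.
Proof. by move=> /funext ->. Qed.

(** Supplies the window bound under which the maximal inequality applies to the process sum_i a_i
    e_{i,t}; the weights will be the jumps and the loadings. *)
Lemma mean_le_weighted (a : nat -> R) (b : int) (k : nat) :
  mean_le P (fun w => (\sum_(1 <= i < N.+1) a i * win (e i) b k w) ^+ 2)
    (S * (\sum_(1 <= i < N.+1) a i * a i) * k%:R).
Proof.
have /= H := @panel_sum_centered (fun i w => a i * win (e i) b k w).
apply: eq_mean_le (mean_leW _ (H _ _)) => [w|||].
- congr (_ ^+ 2); apply: eq_big_nat => i /andP[i1 _].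
  by rewrite ExZ ?Ex_win ?mulr0 ?subr0//; exact/L2_integ/L2_win.
- rewrite mulr_sumr mulr_suml; apply: ler_sum_nat => i /andP[i1 _].
  under [X in Ex P X]eq_fun do rewrite exprMn.
  rewrite ExZ ?e_var//; last exact: (L2_win b k i1).2.
  have /andP[_ sS] := s2_le i1; rewrite -expr2.
  have -> : S * a i ^+ 2 * k%:R = a i ^+ 2 * (S * k%:R) by ring.
  by rewrite ler_wpM2l ?sqr_ge0// ler_wpM2r.
- move=> i i1; apply: measurable_funM; first exact: measurable_cst.
  exact: adapted_win.
- by move=> i i1; apply: L2Z; exact: L2_win.
Qed.

Lemma mean_le_squares (b : int) (k : nat) :
  mean_le P (fun w => \sum_(1 <= i < N.+1) win (e i) b k w ^+ 2) (S * N%:R * k%:R).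
Proof.
have H i : (1 <= i < N.+1)%N -> mean_le P (fun w => win (e i) b k w ^+ 2) (S * k%:R).
  move=> /andP[i1 _]; split; [by move=> w; exact: sqr_ge0|exact: (L2_win b k i1).2|].
  by rewrite e_var// ler_wpM2r//; have /andP[_] := s2_le i1.
under [X in mean_le P X]eq_fun do rewrite big_nat.
apply: mean_leW (mean_le_sum _ H).
rewrite -big_nat sumr_const_nat subn1 -[_ *+ _]mulr_natr /=.
by rewrite mulrAC.
Qed.

Lemma mean_le_fluctuation (b : int) (k : nat) :
  mean_le P
    (fun w => (\sum_(1 <= i < N.+1) (win (e i) b k w ^+ 2 - s2 i * k%:R)) ^+ 2)
    (C4 * N%:R * k%:R ^+ 2).
Proof.
have /= H := @panel_sum_centered (fun i w => win (e i) b k w ^+ 2).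
apply: eq_mean_le (mean_leW _ (H _ _)) => [w|||].
- by congr (_ ^+ 2); apply: eq_big_nat => i /andP[i1 _]; rewrite e_var.
- apply: le_trans (u4_le k); apply: ler_sum_nat => i /andP[i1 _].
  by under [X in Ex P X]eq_fun do rewrite -exprM; rewrite e_u4.
- by move=> i i1; apply: measurable_funX; exact: adapted_win.
- by move=> i i1; exact: e_L4.
Qed.

Section cross_term.
Variables (T t0 : nat).
Hypotheses (T0 : (0 < T)%N) (t0T : (t0 <= T)%N).

Let E0 i w := bridge T (fun t => win (e i) 1 t w) t0.

Let adapted_E0 i : adapted (e i) (E0 i).
Proof.
apply: measurable_funB; first exact: adapted_win.
by apply: measurable_funM; [exact: measurable_cst|exact: adapted_win].
Qed.

Let E0_le i w : E0 i w ^+ 4 <= 8 * win (e i) 1 t0 w ^+ 4 + 8 * win (e i) 1 T w ^+ 4.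
Proof.
have := bridge_sqr (fun t => win (e i) 1 t w) T0 t0T; rewrite -/(E0 i w).
have -> : 4%N = (2 * 2)%N by []. rewrite !exprM.
have := sqr_ge0 (E0 i w).
move: (E0 i w ^+ 2) (win _ _ _ _ ^+ 2) (win _ _ _ _ ^+ 2) => x a b x0 xab.
have : x ^+ 2 <= (2 * a + 2 * b) ^+ 2 by nra.
by move=> h; apply: (le_trans h); have := sqr_ge0 (a - b); nra.
Qed.

Let L2_E0 i : (1 <= i)%N -> L2 P (E0 i).
Proof.
move=> i1.
have := L2D (L2_win 1 t0 i1) (L2Z (- (t0%:R / T%:R)) (L2_win 1 T i1)).
by congr (L2 P _); apply/funext => w; rewrite /E0 /bridge mulNr.
Qed.

Let L4_E0 i : (1 <= i)%N -> L2 P (fun w => E0 i w ^+ 2).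
Proof.
move=> i1; have mE : measurable_fun setT (E0 i) := (L2_E0 i1).1.
split; first exact: measurable_funX.
have h a k : integ P (fun w => 8 * win (e i) a k w ^+ 4).
  apply: integZ; have := (e_L4 a k i1).2.
  by congr (integ P _); apply/funext => w; rewrite -exprM.
apply: integ_le (integD (h 1 t0) (h 1 T)).
  by apply: measurable_funX; exact: measurable_funX.
by move=> w; rewrite ger0_norm ?sqr_ge0// -exprM; exact: E0_le.
Qed.

Let Ex_E0_4 i : (1 <= i)%N -> Ex P (fun w => E0 i w ^+ 4) <= 8 * u4 i t0 + 8 * u4 i T.
Proof.
move=> i1.
have i4 a k : integ P (fun w => win (e i) a k w ^+ 4).
  have := (e_L4 a k i1).2.
  by congr (integ P _); apply/funext => w; rewrite -exprM.
rewrite -(e_u4 1 t0 i1) -(e_u4 1 T i1) -!ExZ// -ExD; try exact: integZ.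
apply: Ex_le => [||w]; last exact: E0_le.
  have := (L4_E0 i1).2.
  by congr (integ P _); apply/funext => w; rewrite -exprM.
by apply: integD; exact: integZ.
Qed.

Hypotheses (C4_gt0 : 0 < C4) (N_gt0 : (0 < N)%N).

Let integ_E0_win i a k : (1 <= i)%N -> integ P (fun w => E0 i w * win (e i) a k w).
Proof. by move=> i1; apply: L2_integM; [exact: L2_E0|exact: L2_win]. Qed.

(** [E0] is a window sum minus t0/T <= 1 times another one; both covariances with [e i r] lie in
    [0, S], hence so does the absolute value of the difference. *)
Let Ex_E0_e i r : (1 <= i)%N -> `|Ex P (fun w => E0 i w * e i r w)| <= S.
Proof.
move=> i1.
have h t : integ P (fun w => win (e i) 1 t w * e i r w).
  by apply: L2_integM; [exact: L2_win|exact: L2_e].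
have -> : Ex P (fun w => E0 i w * e i r w) = Ex P (fun w => win (e i) 1 t0 w * e i r w)
   + (- (t0%:R / T%:R)) * Ex P (fun w => win (e i) 1 T w * e i r w).
  rewrite -ExZ// -ExD//; last exact: integZ.
  by congr (Ex P _); apply/funext => w; rewrite /E0 /bridge; ring.
have /andP[a0 aS] := Ex_win_cross t0 r i1.
have /andP[b0 bS] := Ex_win_cross T r i1.
have /andP[s0 sS] := s2_le i1.
have x0 : 0 <= t0%:R / T%:R :> R by rewrite divr_ge0.
have x1 : t0%:R / T%:R <= 1 :> R by rewrite ler_pdivrMr ?ltr0n// mul1r ler_nat.
by rewrite ler_norml; apply/andP; split; nra.
Qed.

(** The centred cross terms as a process in time: the bridge at t0 is frozen and only the error
    moves with [r], so its windows are again centred panel sums. *)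
Let q (r : int) w := \sum_(1 <= i < N.+1) (E0 i w * e i r w -
  Ex P (fun w => E0 i w * e i r w)).

Let win_q a k w : win q a k w = \sum_(1 <= i < N.+1)
  (E0 i w * win (e i) a k w - Ex P (fun w => E0 i w * win (e i) a k w)).
Proof.
rewrite /win /q exchange_big /=; apply: eq_big_nat => i /andP[i1 _].
rewrite big_split /= -mulr_sumr sumrN; congr (_ - _).
under [in RHS]eq_fun do rewrite mulr_sumr.
rewrite Ex_sum// => j _; apply: L2_integM; [exact: L2_E0|exact: L2_e].
Qed.

Let mean_le_q a k : mean_le P (fun w => win q a k w ^+ 2)
  (9 * (C4 * N%:R * T%:R) * k%:R).
Proof.
have := @panel_sum_centered (fun i w => E0 i w * win (e i) a k w).
under eq_fun do rewrite -win_q.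
move=> H; apply: mean_leW (H _ _).
- have [->|k0] := posnP k.
    rewrite mulr0 big1_seq// => i _.
    rewrite (_ : (fun _ => _) = cst 0) ?Ex_cst//; apply/funext => w.
    by rewrite /win big_geq// mulr0 expr0n.
  have k0' : 0 < k%:R :> R by rewrite ltr0n.
  have T0' : 0 < T%:R :> R by rewrite ltr0n.
  (* Young's inequality with weights k/T and T/k, which balance the fourth moments of order T^2 for
     [E0] and k^2 for the window. It yields 8 + 1/2 times C4 N T k, below the stated 9; the weight
     T/k is why k = 0 was set aside. *)
  apply: (@le_trans _ _ (\sum_(1 <= i < N.+1)
     (k%:R / T%:R * (4 * u4 i t0 + 4 * u4 i T) + T%:R / k%:R * (u4 i k / 2)))).
    apply: ler_sum_nat => i /andP[i1 _].
    have iw : integ P (fun w => win (e i) a k w ^+ 4).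
      have := (e_L4 a k i1).2.
      by congr (integ P _); apply/funext => w; rewrite -exprM.
    have iE : integ P (fun w => E0 i w ^+ 4).
      have := (L4_E0 i1).2.
      by congr (integ P _); apply/funext => w; rewrite -exprM.
    have iEw : integ P (fun w => (E0 i w * win (e i) a k w) ^+ 2).
      have := L2_integM (L4_E0 i1) (e_L4 a k i1).
      by congr (integ P _); apply/funext => w; rewrite exprMn.
    apply: (@le_trans _ _ (Ex P (fun w => k%:R / T%:R / 2 * E0 i w ^+ 4 +
       T%:R / k%:R / 2 * win (e i) a k w ^+ 4))).
      apply: Ex_le => //; first by apply: integD; exact: integZ.
      move=> w; rewrite -subr_ge0.
      have -> : k%:R / T%:R / 2 * E0 i w ^+ 4 + T%:R / k%:R / 2 * win (e i) a k w ^+ 4 -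
        (E0 i w * win (e i) a k w) ^+ 2 = k%:R / T%:R / 2 *
        (E0 i w ^+ 2 - T%:R / k%:R * win (e i) a k w ^+ 2) ^+ 2.
        by field; rewrite !gt_eqF.
      by rewrite mulr_ge0 ?sqr_ge0// !divr_ge0.
    rewrite ExD; try exact: integZ.
    rewrite !ExZ// e_u4// lerD//; last by rewrite -!mulrA (mulrC 2^-1).
    have := Ex_E0_4 i1; have : 0 <= k%:R / T%:R :> R by rewrite divr_ge0.
    nra.
  rewrite big_split /= -!mulr_sumr big_split /= -!mulr_sumr -mulr_suml.
  have h0 := u4_le t0; have hT := u4_le T; have hk := u4_le k.
  have t0T2 : t0%:R ^+ 2 <= T%:R ^+ 2 :> R.
    by rewrite lerXn2r ?nnegrE// ler_nat.
  have CN : 0 <= C4 * N%:R by rewrite mulr_ge0// ltW.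
  set a0 := \sum_(1 <= i < N.+1) u4 i t0 in h0 *.
  set aT := \sum_(1 <= i < N.+1) u4 i T in hT *.
  set ak := \sum_(1 <= i < N.+1) u4 i k in hk *.
  apply: (@le_trans _ _ (k%:R / T%:R * (8 * (C4 * N%:R * T%:R ^+ 2)) +
    T%:R / k%:R * (C4 * N%:R * k%:R ^+ 2 / 2))).
    apply: lerD; apply: ler_wpM2l; rewrite ?divr_ge0//; last by rewrite ler_wpM2r.
    have : C4 * N%:R * t0%:R ^+ 2 <= C4 * N%:R * T%:R ^+ 2 by rewrite ler_wpM2l.
    lra.
  have -> : k%:R / T%:R * (8 * (C4 * N%:R * T%:R ^+ 2)) +
    T%:R / k%:R * (C4 * N%:R * k%:R ^+ 2 / 2) = (17 / 2) * (C4 * N%:R * T%:R) * k%:R.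
    by field; rewrite !gt_eqF.
  apply: ler_wpM2r => //; apply: ler_wpM2r; [by rewrite mulr_ge0|by lra].
- move=> i i1; apply: measurable_funM; first exact: adapted_E0.
  exact: adapted_win.
- move=> i i1; split.
    by apply: measurable_funM; [exact: (L2_E0 i1).1|exact: measurable_win].
  have := L2_integM (L4_E0 i1) (e_L4 a k i1).
  by congr (integ P _); apply/funext => w; rewrite exprMn.
Qed.

(** The mean part [m] changes by at most S N per time step, hence is Lipschitz in t; the centred
    part is an increment of [q]. With l = sqrt(C4 N T) the latter costs l/2 + 40 * 9 l^2 / (2 l),
    that is 180 l + l/2. *)
Lemma cross_term_bound :
  exists K : Omega -> R, mean_le P K (S * N%:R + 181 * Num.sqrt (C4 * N%:R * T%:R))
  /\ forall t w, (t <= T)%N ->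
    `| \sum_(1 <= i < N.+1) E0 i w * (win (e i) 1 t w - win (e i) 1 t0 w) |
       <= (gap t t0)%:R * K w.
Proof.
have [A1 [A2 [_ HA2 HA]]] := process_increments mean_le_q t0T.
set l := Num.sqrt (C4 * N%:R * T%:R).
have CNT : 0 < C4 * N%:R * T%:R by rewrite !mulr_gt0 ?ltr0n.
have l0 : 0 < l by rewrite sqrtr_gt0.
have ll : C4 * N%:R * T%:R = l ^+ 2 by rewrite sqr_sqrtr// ltW.
have S0 : 0 <= S by have /andP[a b] := s2_le (leqnn 1); exact: le_trans a b.
exists (fun w => S * N%:R + (l / 2 + (2 * l)^-1 * A2 w)); split.
  apply: mean_leW (mean_leD (mean_le_cst P _) (mean_leD (mean_le_cst P _) (mean_leZ _ HA2))).
  - rewrite ll; have -> : (2 * l)^-1 * (40 * (9 * l ^+ 2)) = 180 * l.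
      by field; rewrite gt_eqF.
    lra.
  - by rewrite mulr_ge0.
  - by rewrite divr_ge0// ltW.
  - by rewrite invr_ge0 mulr_ge0// ltW.
move=> t w tT; have [_ E2] := HA t w tT.
pose m n := \sum_(1 <= i < N.+1) Ex P (fun w => E0 i w * win (e i) 1 n w).
have -> : \sum_(1 <= i < N.+1) E0 i w * (win (e i) 1 t w - win (e i) 1 t0 w) =
    (m t - m t0) + (win q 1 t w - win q 1 t0 w).
  rewrite !win_q /m -!sumrB -big_split /=; apply: eq_bigr => i _; ring.
apply: (le_trans (ler_normD _ _)); rewrite mulrDr lerD//.
  rewrite mulrC; apply: gap_lipschitz => n.
  rewrite /m -sumrB; apply: (le_trans (ler_norm_sum _ _ _)).
  apply: (@le_trans _ _ (\sum_(1 <= i < N.+1) S)); last first.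
    by rewrite sumr_const_nat subn1 -[_ *+ _]mulr_natr.
  apply: ler_sum_nat => i /andP[i1 _].
  have -> : Ex P (fun w => E0 i w * win (e i) 1 n.+1 w) -
      Ex P (fun w => E0 i w * win (e i) 1 n w) =
      Ex P (fun w => E0 i w * e i (1 + n%:Z) w).
    have i_e : integ P (fun w => E0 i w * e i (1 + n%:Z) w).
      by apply: L2_integM; [exact: L2_E0|exact: L2_e].
    apply/eqP; rewrite subr_eq; apply/eqP; rewrite -ExD//; last exact: integ_E0_win.
    congr (Ex P _); apply/funext => w'.
    by rewrite -addn1 win_cat win1; ring.
  exact: Ex_E0_e.
have [a2 _ _] := HA2.
have -> : l / 2 + (2 * l)^-1 * A2 w = (l + A2 w / l) / 2.
  by field; rewrite gt_eqF.
exact: norm_le_weighted.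
Qed.

(** Replacing window sums by bridges adds ((t - t0)/T) sum_i E0_i Z_i, with Z_i the full sum of
    panel i. The bound of E0_i Z_i by half the sum of squares costs 5/2 S N in the mean. *)
Lemma cross_bridge_bound :
  exists K : Omega -> R,
    mean_le P K (4 * S * N%:R + 181 * Num.sqrt (C4 * N%:R * T%:R)) /\
  forall t w, (t <= T)%N ->
    `| \sum_(1 <= i < N.+1) E0 i w * (bridge T (fun t => win (e i) 1 t w) t - E0 i w) |
       <= (gap t t0)%:R * K w.
Proof.
have [K [mK HK]] := cross_term_bound.
have T0' : 0 < T%:R :> R by rewrite ltr0n.
have S0 : 0 <= S by have /andP[a b] := s2_le (leqnn 1); exact: le_trans a b.
pose Z i w := win (e i) 1 T w.
have mZ := mean_le_squares.
have T20 : 0 <= (2 * T%:R)^-1 :> R by rewrite invr_ge0 mulr_ge0.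
exists (fun w => K w + (2 * T%:R)^-1 *
  \sum_(1 <= i < N.+1) (E0 i w ^+ 2 + Z i w ^+ 2)); split.
  have H : mean_le P (fun w => 2 * (\sum_(1 <= i < N.+1) win (e i) 1 t0 w ^+ 2) +
      3 * (\sum_(1 <= i < N.+1) win (e i) 1 T w ^+ 2))
      (2 * (S * N%:R * t0%:R) + 3 * (S * N%:R * T%:R)).
    by apply: mean_leD; apply: mean_leZ.
  have H5 : 2 * (S * N%:R * t0%:R) + 3 * (S * N%:R * T%:R) <= 5 * (S * N%:R * T%:R).
    have : S * N%:R * t0%:R <= S * N%:R * T%:R.
      by rewrite ler_wpM2l ?mulr_ge0// ler_nat.
    lra.
  have H' : mean_le P (fun w => \sum_(1 <= i < N.+1) (E0 i w ^+ 2 + Z i w ^+ 2))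
      (5 * (S * N%:R * T%:R)).
    apply: mean_leW H5 (mean_le_dom _ _ H).
      apply: measurable_sum => i; apply: measurable_funD; apply: measurable_funX.
        apply: measurable_funB; first exact: measurable_win.
        by apply: measurable_funM => //; exact: measurable_win.
      exact: measurable_win.
    move=> w; apply/andP; split.
      by apply: sumr_ge0 => i _; rewrite addr_ge0 ?sqr_ge0.
    rewrite !mulr_sumr -big_split /=; apply: ler_sum => i _.
    have := bridge_sqr (fun t => win (e i) 1 t w) T0 t0T.
    rewrite -/(E0 i w) /Z; lra.
  apply: mean_leW (mean_leD mK (mean_leZ T20 H')).
  have -> : (2 * T%:R)^-1 * (5 * (S * N%:R * T%:R)) = 5 / 2 * (S * N%:R).
    by field; rewrite gt_eqF.
  have : 0 <= S * N%:R by rewrite mulr_ge0.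
  lra.
move=> t w tT.
have -> : \sum_(1 <= i < N.+1) E0 i w * (bridge T (fun t => win (e i) 1 t w) t - E0 i w) =
  \sum_(1 <= i < N.+1) E0 i w * (win (e i) 1 t w - win (e i) 1 t0 w) -
  (t%:R - t0%:R) * (T%:R^-1 * \sum_(1 <= i < N.+1) E0 i w * Z i w).
  rewrite !mulr_sumr -sumrB; apply: eq_bigr => i _; rewrite /Z {2}/E0 /bridge; ring.
apply: (le_trans (ler_normB _ _)); rewrite mulrDr lerD ?HK// normrM.
have -> : `|t%:R - t0%:R| = (gap t t0)%:R :> R.
  apply/eqP; rewrite -(@eqrXn2 _ 2)// sqr_gap.
  by rewrite real_normK// num_real.
apply: ler_wpM2l => //.
rewrite normrM ger0_norm ?invr_ge0// invfM [2^-1 * _]mulrC -mulrA.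
apply: ler_wpM2l; first by rewrite invr_ge0.
apply: (le_trans (ler_norm_sum _ _ _)); rewrite mulr_sumr; apply: ler_sum => i _.
rewrite normrM -(real_normK (num_real (E0 i w))) -(real_normK (num_real (Z i w))).
have := sqr_ge0 (`|E0 i w| - `|Z i w|); lra.
Qed.

(** The squared increments of the window sums split into their mean, at most S N per unit of gap,
    and the fluctuation [F]. Since F(t)^2 / gap^2 has mean O(N), summing over all t costs only O(N
    T), and the root is of order sqrt(N T). *)
Lemma square_term_bound :
  exists B : Omega -> R,
    mean_le P B (4 * S * N%:R + 3 * Num.sqrt (C4 * N%:R * T%:R)) /\
  forall t w, (t <= T)%N ->
    \sum_(1 <= i < N.+1) (bridge T (fun t => win (e i) 1 t w) t - E0 i w) ^+ 2
      <= (gap t t0)%:R * B w.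
Proof.
set l := Num.sqrt (C4 * N%:R * T%:R).
have CNT : 0 < C4 * N%:R * T%:R by rewrite !mulr_gt0 ?ltr0n.
have l0 : 0 < l by rewrite sqrtr_gt0.
have ll : C4 * N%:R * T%:R = l ^+ 2 by rewrite sqr_sqrtr// ltW.
have S0 : 0 <= S by have /andP[a b] := s2_le (leqnn 1); exact: le_trans a b.
have T0' : 0 < T%:R :> R by rewrite ltr0n.
pose F t w := \sum_(1 <= i < N.+1)
  (win (e i) (1 + (minn t t0)%:Z) (gap t t0) w ^+ 2 - s2 i * (gap t t0)%:R).
(* At t = t0 the gap is 0 and its inverse is 0 by convention; nothing is lost, as [F] vanishes
   there. *)
pose A w := \sum_(0 <= t < T.+1) ((gap t t0)%:R ^+ 2)^-1 * F t w ^+ 2.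
have mA : mean_le P A (2 * (C4 * N%:R * T%:R)).
  have H : mean_le P A (\sum_(0 <= t < T.+1)
      ((gap t t0)%:R ^+ 2)^-1 * (C4 * N%:R * (gap t t0)%:R ^+ 2)).
    apply: mean_le_sum => t _; apply: mean_leZ; last exact: mean_le_fluctuation.
    by rewrite invr_ge0 exprn_ge0.
  apply: mean_leW H.
  apply: (@le_trans _ _ (\sum_(0 <= t < T.+1) (C4 * N%:R))).
    apply: ler_sum_nat => t _; have [->|g0] := eqVneq (gap t t0) 0%N.
      by rewrite expr0n !mulr0 mulr_ge0// ltW.
    by rewrite mulrCA mulVf ?mulr1// expf_neq0// pnatr_eq0.
  rewrite sumr_const_nat subn0 -[_ *+ _]mulr_natr -natr1.
  have : 1 <= T%:R :> R by rewrite ler1n.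
  have : 0 <= C4 * N%:R by rewrite mulr_ge0// ltW.
  nra.
exists (fun w => 2 * (S * N%:R + (l / 2 + (2 * l)^-1 * A w)) +
  2 / T%:R * \sum_(1 <= i < N.+1) win (e i) 1 T w ^+ 2); split.
  apply: mean_leW (mean_leD (mean_leZ _ (mean_leD (mean_le_cst P _)
   (mean_leD (mean_le_cst P _) (mean_leZ _ mA)))) (mean_leZ _ (mean_le_squares 1 T))) => //.
  - rewrite ll; have -> : (2 * l)^-1 * (2 * l ^+ 2) = l by field; rewrite gt_eqF.
    have -> : 2 / T%:R * (S * N%:R * T%:R) = 2 * S * N%:R by field; rewrite gt_eqF.
    lra.
  - by rewrite mulr_ge0.
  - by rewrite divr_ge0// ltW.
  - by rewrite invr_ge0 mulr_ge0// ltW.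
move=> t w tT; have [A0 _ _] := mA.
have g0 : 0 <= (gap t t0)%:R :> R by [].
have gT : (gap t t0)%:R <= T%:R :> R by rewrite ler_nat /gap; lia.
have FA : F t w ^+ 2 <= (gap t t0)%:R ^+ 2 * A w.
  have [g00|gn0] := eqVneq (gap t t0) 0%N.
    rewrite /F g00 expr0n mul0r big1_seq ?expr0n// => i _.
    by rewrite /win big_geq// expr0n mulr0 subrr.
  have g2 : 0 < (gap t t0)%:R ^+ 2 :> R by rewrite exprn_gt0// ltr0n lt0n.
  rewrite -ler_pdivrMl// /A (bigD1_seq t) ?iota_uniq//=; last first.
    by rewrite mem_index_iota; lia.
  rewrite lerDl; apply: sumr_ge0 => u _.
  by rewrite mulr_ge0 ?sqr_ge0// invr_ge0 sqr_ge0.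
have := norm_le_weighted g0 (A0 w) l0 FA.
have -> : (l + A w / l) / 2 = l / 2 + (2 * l)^-1 * A w by field; rewrite gt_eqF.
move=> /(le_trans (ler_norm _)) FB.
set Sz := \sum_(1 <= i < N.+1) win (e i) 1 T w ^+ 2.
pose z i := win (e i) 1 t w - win (e i) 1 t0 w.
have zF : \sum_(1 <= i < N.+1) z i ^+ 2 =
    F t w + (gap t t0)%:R * \sum_(1 <= i < N.+1) s2 i.
  rewrite mulr_sumr /F -big_split /=; apply: eq_bigr => i _.
  by rewrite /z win_gap mulrC subrK.
have s2S : \sum_(1 <= i < N.+1) s2 i <= S * N%:R.
  apply: (@le_trans _ _ (\sum_(1 <= i < N.+1) S)).
    by apply: ler_sum_nat => i /andP[i1 _]; have /andP[] := s2_le i1.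
  by rewrite sumr_const_nat subn1 -[_ *+ _]mulr_natr.
have Sz0 : 0 <= Sz by apply: sumr_ge0 => i _; exact: sqr_ge0.
apply: (@le_trans _ _ (2 * (\sum_(1 <= i < N.+1) z i ^+ 2) +
   2 * (gap t t0)%:R ^+ 2 * (Sz / T%:R ^+ 2))).
  rewrite /Sz mulr_suml !mulr_sumr -big_split /=; apply: ler_sum => i _.
  exact: (bridge_diff_sqr (fun t => win (e i) 1 t w) t0 t T0).
have gg : (gap t t0)%:R ^+ 2 * (Sz / T%:R ^+ 2) <= (gap t t0)%:R * (Sz / T%:R).
  rewrite -subr_ge0.
  have -> : (gap t t0)%:R * (Sz / T%:R) - (gap t t0)%:R ^+ 2 * (Sz / T%:R ^+ 2) =
     (gap t t0)%:R * (Sz / T%:R ^+ 2) * (T%:R - (gap t t0)%:R).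
    by field; rewrite gt_eqF.
  apply: mulr_ge0; last by rewrite subr_ge0.
  by apply: mulr_ge0 => //; apply: divr_ge0 => //; exact: exprn_ge0.
have -> : 2 / T%:R * Sz = 2 * (Sz / T%:R) by rewrite mulrAC mulrA.
rewrite zF.
have : (gap t t0)%:R * \sum_(1 <= i < N.+1) s2 i <= (gap t t0)%:R * (S * N%:R).
  by rewrite ler_wpM2l.
nra.
Qed.

End cross_term.

End panels.

(** * Pathwise decomposition of the criterion *)

Section pathwise.
Context (R : realType).
Implicit Types (T t : nat).

(** The accumulated indicator of times after t0: truncated subtraction makes it 0 up to t0. *)
Definition jump t0 t : R := (t - t0)%:R.

Lemma bridge_jump_le T t0 t : (0 < T)%N -> (t <= t0)%N -> (t0 <= T)%N ->
  bridge T (jump t0) t = - (t%:R * (T%:R - t0%:R) / T%:R).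
Proof.
move=> T0 tt0 t0T; rewrite /bridge /jump (eqP tt0) natrB//.
by field; rewrite gt_eqF// ltr0n.
Qed.

Lemma bridge_jump_ge T t0 t : (0 < T)%N -> (t0 <= t)%N -> (t0 <= T)%N ->
  bridge T (jump t0) t = - (t0%:R * (T%:R - t%:R) / T%:R).
Proof.
move=> T0 t0t t0T; rewrite /bridge /jump !natrB//.
by field; rewrite gt_eqF// ltr0n.
Qed.

(** Up to sign, [g] is a tent with tip at t0. With a = t0/T and b = 1 - a, its height is a b T and
    its slopes are b and a, so g(t0)^2 - g(t)^2 is at least slope times gap times height, hence at
    least (a b)^2 T gap. [x] and [y] are lower bounds for a and b. *)
Lemma bridge_jump_bounds T t0 t (x y : R) :
  0 <= x -> 0 <= y -> (t <= T)%N -> (t0 <= T)%N -> (0 < T)%N ->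
  x * T%:R <= t0%:R -> y * T%:R <= T%:R - t0%:R ->
  let g := bridge T (jump t0) in
  [/\ `|g t| <= T%:R, `|g t - g t0| <= (gap t t0)%:R &
      (x * y) ^+ 2 * T%:R * (gap t t0)%:R <= g t0 ^+ 2 - g t ^+ 2].
Proof.
move=> x0 y0 tT t0T T0 xt yt /=.
have T0' : 0 < T%:R :> R by rewrite ltr0n.
pose a := t0%:R / T%:R : R; pose b := 1 - a.
have aT : t0%:R = a * T%:R by rewrite /a divfK// gt_eqF.
have xa : x <= a by rewrite ler_pdivlMr.
have yb : y <= b by rewrite /b lerBrDl -(ler_pM2r T0') mulrDl -aT mul1r; lra.
have a1 : a <= 1 by rewrite ler_pdivrMr// mul1r ler_nat.
have b1 : b <= 1 by rewrite /b; lra.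
have a0 : 0 <= a by exact: le_trans xa.
have b0 : 0 <= b by exact: le_trans yb.
have xy : (x * y) ^+ 2 <= (a * b) ^+ 2.
  by rewrite lerXn2r ?nnegrE ?mulr_ge0// ler_pM.
have tR : t%:R <= T%:R :> R by rewrite ler_nat.
have tp : 0 <= t%:R :> R by [].
have ab1 : a * b <= 1 by nra.
have abT : 0 <= a * b by rewrite mulr_ge0.
have [le|/ltnW le] := leqP t t0.
- have -> : bridge T (jump t0) t = - (t%:R * b).
    by rewrite bridge_jump_le// /b /a; field; rewrite gt_eqF.
  have -> : bridge T (jump t0) t0 = - (t0%:R * b).
    by rewrite bridge_jump_le// /b /a; field; rewrite gt_eqF.
  have -> : (gap t t0)%:R = t0%:R - t%:R :> R by rewrite /gap (eqP le) natrB.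
  have leR : t%:R <= t0%:R :> R by rewrite ler_nat.
  split.
  + by rewrite normrN ger0_norm ?mulr_ge0//; nra.
  + rewrite ler_norml; apply/andP; split; nra.
  + rewrite !sqrrN.
    have -> : (t0%:R * b) ^+ 2 - (t%:R * b) ^+ 2 =
      b ^+ 2 * (t0%:R - t%:R) * (t0%:R + t%:R) by ring.
    apply: (@le_trans _ _ ((a * b) ^+ 2 * T%:R * (t0%:R - t%:R))).
      by rewrite ler_wpM2r ?subr_ge0// ler_wpM2r// ltW.
    apply: (@le_trans _ _ (b ^+ 2 * (t0%:R - t%:R) * t0%:R)); last first.
      by rewrite ler_wpM2l ?lerDl// mulr_ge0 ?sqr_ge0 ?subr_ge0.
    have -> : (a * b) ^+ 2 * T%:R * (t0%:R - t%:R) =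
      b ^+ 2 * (t0%:R - t%:R) * (a * t0%:R) by rewrite aT; ring.
    apply: ler_wpM2l; first by rewrite mulr_ge0 ?sqr_ge0 ?subr_ge0.
    by rewrite ler_piMl.
- have -> : bridge T (jump t0) t = - (a * (T%:R - t%:R)).
    by rewrite bridge_jump_ge// /a; field; rewrite gt_eqF.
  have -> : bridge T (jump t0) t0 = - (a * (T%:R - t0%:R)).
    by rewrite bridge_jump_ge// /a; field; rewrite gt_eqF.
  have -> : (gap t t0)%:R = t%:R - t0%:R :> R by rewrite /gap (eqP le) addn0 natrB.
  have leR : t0%:R <= t%:R :> R by rewrite ler_nat.
  have bT : T%:R - t0%:R = b * T%:R by rewrite aT /b; ring.
  split.
  + by rewrite normrN ger0_norm ?mulr_ge0 ?subr_ge0//; nra.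
  + rewrite ler_norml; apply/andP; split; nra.
  + rewrite !sqrrN.
    have -> : (a * (T%:R - t0%:R)) ^+ 2 - (a * (T%:R - t%:R)) ^+ 2 =
      a ^+ 2 * (t%:R - t0%:R) * ((T%:R - t0%:R) + (T%:R - t%:R)) by ring.
    apply: (@le_trans _ _ ((a * b) ^+ 2 * T%:R * (t%:R - t0%:R))).
      by rewrite ler_wpM2r ?subr_ge0// ler_wpM2r// ltW.
    apply: (@le_trans _ _ (a ^+ 2 * (t%:R - t0%:R) * (T%:R - t0%:R))); last first.
      by rewrite ler_wpM2l ?lerDl ?subr_ge0// mulr_ge0 ?sqr_ge0 ?subr_ge0.
    have -> : (a * b) ^+ 2 * T%:R * (t%:R - t0%:R) =
      a ^+ 2 * (t%:R - t0%:R) * (b * (T%:R - t0%:R)) by rewrite bT; ring.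
    apply: ler_wpM2l; first by rewrite mulr_ge0 ?sqr_ge0 ?subr_ge0.
    by rewrite ler_piMl// subr_ge0 ler_nat.
Qed.

(** Grouped so that every summand carries an increment between t0 and t, of the jump, the factor or
    the errors; thus each can be compared with the gap. *)
Lemma square_sum_decomposition (N : nat) (D G E E0 : nat -> R) (g g0 H H0 : R) :
  let dot a b := \sum_(1 <= i < N.+1) a i * b i : R in
  let eps i := E i - E0 i in
  \sum_(1 <= i < N.+1) (D i * g + G i * H + E i) ^+ 2 -
  \sum_(1 <= i < N.+1) (D i * g0 + G i * H0 + E0 i) ^+ 2 =
  dot D D * (g ^+ 2 - g0 ^+ 2) +
  2 * g * (dot D G * (H - H0) + dot D eps) +
  2 * (g - g0) * (dot D G * H0 + dot D E0) +
  (\sum_(1 <= i < N.+1) (G i * (H - H0) + eps i) ^+ 2) +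
  2 * (dot G G * H0 * (H - H0) + H0 * dot G eps + (H - H0) * dot G E0 + dot E0 eps).
Proof.
move=> dot eps; rewrite /dot /eps -sumrB.
rewrite ?(mulr_sumr, mulr_suml) -?big_split /=.
rewrite ?(mulr_sumr, mulr_suml) -?big_split /=.
rewrite ?(mulr_sumr, mulr_suml) -?big_split /=.
rewrite ?(mulr_sumr, mulr_suml) -?big_split /=.
apply: eq_bigr => i _; ring.
Qed.

(** The weighted AM-GM step for an increment [x] multiplied by a quantity [y] that stays fixed as t
    varies. *)
Lemma norm_mul_weighted (x y k A l : R) : 0 <= k -> 0 <= A -> 0 < l ->
  x ^+ 2 <= k ^+ 2 * A -> 2 * `|y * x| <= k * (y ^+ 2 / l + l * A).
Proof.
move=> k0 A0 l0 xkA.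
have l0' := ltW l0.
have B0 : 0 <= k * (y ^+ 2 / l + l * A).
  apply: mulr_ge0 => //; apply: addr_ge0; last exact: mulr_ge0.
  by apply: divr_ge0 => //; exact: sqr_ge0.
have n0 : 0 <= 2 * `|y * x| by rewrite mulr_ge0.
rewrite -ler_sqr ?nnegrE//=.
have -> : (2 * `|y * x|) ^+ 2 = 2 ^+ 2 * (y ^+ 2 * x ^+ 2).
  by rewrite exprMn real_normK ?num_real// exprMn.
apply: (@le_trans _ _ (2 ^+ 2 * (y ^+ 2 * (k ^+ 2 * A)))).
  by rewrite ler_wpM2l// ler_wpM2l ?sqr_ge0.
rewrite -subr_ge0.
have -> : (k * (y ^+ 2 / l + l * A)) ^+ 2 - 2 ^+ 2 * (y ^+ 2 * (k ^+ 2 * A)) =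
  (k * (y ^+ 2 / l - l * A)) ^+ 2 by field; rewrite gt_eqF.
exact: sqr_ge0.
Qed.

(** [H1] serves the squared factor increment, while [H2], [D2] and [G2] serve increments of the
    factor and of the weighted errors that occur linearly; here [D2] and [G2] are such random
    bounds, not sums of squared jumps or loadings. The weights [l1], [l2], [L] stay free until the
    means are known. *)
Lemma criterion_drop (N T : nat) (D G E E0 : nat -> R) (g g0 H H0 k c : R)
    (H1 H2 D2 G2 B K l1 l2 L : R) :
  let dot a b := \sum_(1 <= i < N.+1) a i * b i : R in
  let eps i := E i - E0 i in
  0 <= k -> 0 < l1 -> 0 < l2 -> 0 < L -> 0 <= H2 -> 0 <= D2 -> 0 <= G2 ->
  `|g| <= T%:R -> `|g - g0| <= k -> c * T%:R * k <= g0 ^+ 2 - g ^+ 2 ->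
  (H - H0) ^+ 2 <= k * H1 -> (H - H0) ^+ 2 <= k ^+ 2 * H2 ->
  dot D eps ^+ 2 <= k ^+ 2 * D2 -> dot G eps ^+ 2 <= k ^+ 2 * G2 ->
  \sum_(1 <= i < N.+1) eps i ^+ 2 <= k * B -> `|dot E0 eps| <= k * K ->
  \sum_(1 <= i < N.+1) (D i * g + G i * H + E i) ^+ 2 -
  \sum_(1 <= i < N.+1) (D i * g0 + G i * H0 + E0 i) ^+ 2 <=
  k * ((T%:R * `|dot D G| * (1 + H2) + T%:R * (l1 + D2 / l1) +
    `|dot D G| * (1 + H0 ^+ 2) + (l2 + dot D E0 ^+ 2 / l2) +
    (2 * dot G G * H1 + 2 * B) + dot G G * (H0 ^+ 2 / L + L * H2) +
    (H0 ^+ 2 / L + L * G2) + (dot G E0 ^+ 2 / L + L * H2) + 2 * K)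
   - c * dot D D * T%:R).
Proof.
move=> dot eps k0 l10 l20 L0 H20 D20 G20 gT gg0 gk hH1 hH2 hD hG hB hK.
have dotp a : 0 <= dot a a by apply: sumr_ge0 => i _; rewrite -expr2 sqr_ge0.
have T0 : 0 <= T%:R :> R by [].
set h := H - H0 in hH1 hH2 *.
have t0 : dot D D * (g ^+ 2 - g0 ^+ 2) <= k * (- (c * dot D D * T%:R)).
  rewrite -[leLHS]opprK -mulrN opprB mulrN lerN2.
  have -> : k * (c * dot D D * T%:R) = dot D D * (c * T%:R * k) by ring.
  exact: ler_wpM2l.
have nh := @norm_mul_weighted h 1 k H2 1 k0 H20 ltr01 hH2.
rewrite mul1r expr1n divr1 mul1r in nh.
have nd := norm_mul_weighted 1 k0 D20 (l := l1^-1) _ hD.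
rewrite mul1r expr1n invrK mul1r invr_gt0 [_^-1 * _]mulrC in nd.
have {}nd := nd l10.
have t1 : 2 * g * (dot D G * h + dot D eps) <=
    k * (T%:R * `|dot D G| * (1 + H2) + T%:R * (l1 + D2 / l1)).
  apply: (@le_trans _ _ (T%:R * (`|dot D G| * (2 * `|h|) + 2 * `|dot D eps|))).
    apply: (le_trans (ler_norm _)).
    have -> : 2 * g * (dot D G * h + dot D eps) =
      g * (dot D G * (2 * h) + 2 * dot D eps) by ring.
    rewrite normrM; apply: ler_pM => //.
    by apply: (le_trans (ler_normD _ _)); rewrite !normrM (ger0_norm (ler0n _ 2)).
  have -> : k * (T%:R * `|dot D G| * (1 + H2) + T%:R * (l1 + D2 / l1)) =
    T%:R * (`|dot D G| * (k * (1 + H2)) + k * (l1 + D2 / l1)) by ring.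
  by rewrite ler_wpM2l// lerD// ler_wpM2l.
have nH0 : 2 * `|H0| <= 1 + H0 ^+ 2.
  rewrite -(real_normK (num_real H0)).
  by have := sqr_ge0 (`|H0| - 1); nra.
have nD0 : 2 * `|dot D E0| <= l2 + dot D E0 ^+ 2 / l2.
  rewrite -subr_ge0 -(real_normK (num_real (dot D E0))).
  have -> : l2 + `|dot D E0| ^+ 2 / l2 - 2 * `|dot D E0| =
    (l2 - `|dot D E0|) ^+ 2 / l2 by field; rewrite gt_eqF.
  by rewrite divr_ge0 ?sqr_ge0// ltW.
have t2 : 2 * (g - g0) * (dot D G * H0 + dot D E0) <=
    k * (`|dot D G| * (1 + H0 ^+ 2) + (l2 + dot D E0 ^+ 2 / l2)).
  apply: (le_trans (ler_norm _)).
  have -> : 2 * (g - g0) * (dot D G * H0 + dot D E0) =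
    (g - g0) * (dot D G * (2 * H0) + 2 * dot D E0) by ring.
  rewrite normrM; apply: ler_pM => //.
  apply: (le_trans (ler_normD _ _)); rewrite !normrM (ger0_norm (ler0n _ 2)).
  by rewrite lerD// ler_wpM2l.
have t3 : \sum_(1 <= i < N.+1) (G i * h + eps i) ^+ 2 <=
    k * (2 * dot G G * H1 + 2 * B).
  apply: (@le_trans _ _ (2 * (dot G G * h ^+ 2) +
      2 * \sum_(1 <= i < N.+1) eps i ^+ 2)).
    rewrite /dot mulr_suml !mulr_sumr -big_split /=; apply: ler_sum => i _.
    by have := sqr_ge0 (G i * h - eps i); nra.
  have := ler_wpM2l (dotp G) hH1; nra.
have t4 : 2 * (dot G G * H0 * h) <= k * (dot G G * (H0 ^+ 2 / L + L * H2)).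
  have := ler_wpM2l (dotp G) (norm_mul_weighted H0 k0 H20 L0 hH2).
  have := ler_wpM2l (dotp G) (ler_norm (H0 * h)).
  move: (`|H0 * h|) (H0 ^+ 2 / L + L * H2) => u v; nra.
have t5 : 2 * (H0 * dot G eps) <= k * (H0 ^+ 2 / L + L * G2).
  have := norm_mul_weighted H0 k0 G20 L0 hG.
  by have := ler_norm (H0 * dot G eps); lra.
have t6 : 2 * (h * dot G E0) <= k * (dot G E0 ^+ 2 / L + L * H2).
  have := norm_mul_weighted (dot G E0) k0 H20 L0 hH2; rewrite mulrC.
  by have := ler_norm (dot G E0 * h); rewrite [h * _]mulrC; lra.
have t7 : 2 * dot E0 eps <= k * (2 * K).
  by have := ler_norm (dot E0 eps); lra.
rewrite square_sum_decomposition; apply: (@le_trans _ _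
  (dot D D * (g ^+ 2 - g0 ^+ 2) + 2 * g * (dot D G * h + dot D eps) +
   2 * (g - g0) * (dot D G * H0 + dot D E0) +
   \sum_(1 <= i < N.+1) (G i * h + eps i) ^+ 2 +
   2 * (dot G G * H0 * h + H0 * dot G eps + h * dot G E0 + dot E0 eps))) => //.
lra.
Qed.

End pathwise.

(** * The panel model and the probability of mislocation *)

Lemma win_lincomb d (Omega : measurableType d) (R : realType) N (a : nat -> R)
    (e : nat -> int -> Omega -> R) b k w :
  win (fun t w => \sum_(1 <= i < N.+1) a i * e i t w) b k w =
  \sum_(1 <= i < N.+1) a i * win (e i) b k w.
Proof.
rewrite /win exchange_big /=; apply: eq_bigr => i _.
by rewrite mulr_sumr.
Qed.

Lemma bridge_sum (R : realType) N (a : nat -> R) (f : nat -> nat -> R) T t :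
  bridge T (fun t => \sum_(1 <= i < N.+1) a i * f i t) t =
  \sum_(1 <= i < N.+1) a i * bridge T (f i) t.
Proof.
rewrite /bridge mulr_sumr -sumrB; apply: eq_bigr => i _; ring.
Qed.

Lemma cusum_panel d (Omega : measurableType d) (R : realType) mu delta gamma
    (eta : int -> Omega -> R) (e : nat -> int -> Omega -> R) t0 N T i t w :
  cusum (panel mu delta gamma eta e t0 N T) i t w =
  t%:R * mu i + delta N T i * jump R t0 t + gamma N T i * win eta 1 t w +
  win (e i) 1 t w.
Proof.
have H (f : nat -> R) : \sum_(1 <= s < t.+1) f s = \sum_(0 <= s < t) f s.+1.
  by rewrite big_add1.
have W (X : int -> Omega -> R) : win X 1 t w = \sum_(1 <= s < t.+1) X s%:Z w.
  by rewrite -partial_sum_win.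
rewrite /cusum /panel !big_split /= -!mulr_sumr -!W sumr_const_nat subn1 mulr_natl.
congr (_ + _ * _ + _ + _); rewrite /jump.
elim: t {H W} => [|t ih]; first by rewrite big_geq.
rewrite big_nat_recr//= ih -natrD; congr (_%:R).
by case: ltnP => /= ?; lia.
Qed.

Lemma cusum_panel_bridge d (Omega : measurableType d) (R : realType) mu delta gamma
    (eta : int -> Omega -> R) (e : nat -> int -> Omega -> R) t0 N T w t :
  (0 < T)%N ->
  cusum_criterion (panel mu delta gamma eta e t0 N T) N T w t =
  \sum_(1 <= i < N.+1) (delta N T i * bridge T (jump R t0) t +
    gamma N T i * bridge T (fun t => win eta 1 t w) t +
    bridge T (fun t => win (e i) 1 t w) t) ^+ 2.
Proof.
move=> T0; rewrite /cusum_criterion; apply: eq_bigr => i _; congr (_ ^+ 2).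
rewrite !cusum_panel /bridge; field.
by rewrite pnatr_eq0 -lt0n.
Qed.

Section mislocation.
Context d (Omega : measurableType d) (R : realType) (P : probability Omega R).
Variables (e : nat -> int -> Omega -> R) (s2 : nat -> R) (S C4 : R) (N : nat).
Variable u4 : nat -> nat -> R.
Hypothesis me : forall i t, measurable_fun setT (e i t).
Hypothesis e_indep : independent_sequences P e.
Hypothesis e_mean : forall i t, (1 <= i)%N -> Ex P (e i t) = 0.
Hypothesis e_var : forall i a k, (1 <= i)%N ->
  Ex P (fun w => win (e i) a k w ^+ 2) = s2 i * k%:R.
Hypothesis s2_le : forall i, (1 <= i)%N -> 0 <= s2 i <= S.
Hypothesis e_L4 : forall i a k, (1 <= i)%N ->
  L2 P (fun w => win (e i) a k w ^+ 2).
Hypothesis e_u4 : forall i a k, (1 <= i)%N ->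
  Ex P (fun w => win (e i) a k w ^+ 4) = u4 i k.
Hypothesis u4_le : forall k, \sum_(1 <= i < N.+1) u4 i k <= C4 * N%:R * k%:R ^+ 2.
Hypothesis (C4_gt0 : 0 < C4) (N_gt0 : (0 < N)%N).
Variables (eta : int -> Omega -> R) (ce : R).
Hypothesis meta : forall t, measurable_fun setT (eta t).
Hypothesis eta_var : forall a k, mean_le P (fun w => win eta a k w ^+ 2) (ce * k%:R).
Variables (mu : nat -> R) (delta gamma : nat -> nat -> nat -> R) (t0 T : nat) (x y : R).
Hypotheses (x_gt0 : 0 < x) (y_gt0 : 0 < y).
Hypotheses (t0T : (1 <= t0 < T)%N).
Hypotheses (xt0 : x * T%:R <= t0%:R) (yt0 : y * T%:R <= T%:R - t0%:R).
Let D2 := panel_dot delta delta N T.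
Let Sg := panel_dot delta gamma N T.
Let G2 := panel_dot gamma gamma N T.
(** Holds eventually since Delta -> oo; it lets terms of order T be absorbed by T sqrt Delta. *)
Hypothesis D2_ge1 : 1 <= D2.

Let criterion w t :=
  cusum_criterion (panel mu delta gamma eta e t0 N T) N T w t.

(** The constant comes from the roots of order sqrt(N T): they enter with 2 * 3 + 2 * 181 = 368 and
    are bounded by C4 N + T, and two further terms of order T sqrt Delta give 370. All other
    coefficients fit under it. *)
Lemma criterion_drop_bound :
  exists A : Omega -> R,
    mean_le P A (370 * (1 + ce + S + C4) *
      (T%:R * `|Sg| + T%:R * Num.sqrt D2 + G2 * Num.sqrt T%:R + N%:R)) /\
    forall w t, (t <= T)%N ->
      criterion w t - criterion w t0 <=
      (gap t t0)%:R * (A w - (x * y) ^+ 2 * D2 * T%:R).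
Proof.
have T0 : (0 < T)%N by lia.
have t0T' : (t0 <= T)%N by lia.
have T0' : 0 < T%:R :> R by rewrite ltr0n.
have T1 : 1 <= T%:R :> R by rewrite ler1n.
have S0 : 0 <= S by have /andP[a b] := s2_le (leqnn 1); exact: le_trans a b.
have ce0 : 0 <= ce.
  have [f0 _ fc] := eta_var 0 1; rewrite -(mulr1 ce); apply: le_trans fc.
  exact: Ex_ge0.
have G20 : 0 <= G2 by apply: sumr_ge0 => i _; rewrite -expr2 sqr_ge0.
have D20 : 0 < D2 by exact: lt_le_trans D2_ge1.
set rT := Num.sqrt T%:R; set rD := Num.sqrt D2.
have rT0 : 0 < rT by rewrite sqrtr_gt0.
have rD0 : 0 < rD by rewrite sqrtr_gt0.
have TE : T%:R = rT ^+ 2 by rewrite sqr_sqrtr// ltW.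
have DE : D2 = rD ^+ 2 by rewrite sqr_sqrtr// ltW.
have rT1 : 1 <= rT by rewrite -[leLHS]sqrtr1 ler_sqrt// ltW.
have rD1 : 1 <= rD by rewrite -[leLHS]sqrtr1 ler_sqrt// ltW.
set lam := Num.sqrt (C4 * N%:R * T%:R).
have CN0 : 0 < C4 * N%:R by rewrite mulr_gt0// ltr0n.
have lamE : lam ^+ 2 = C4 * N%:R * T%:R.
  by rewrite sqr_sqrtr// mulr_ge0// ltW.
have lam_le : lam <= C4 * N%:R + T%:R.
  have l0 : 0 <= lam by exact: sqrtr_ge0.
  have := sqr_ge0 (C4 * N%:R - T%:R); nra.
pose Yd t w := \sum_(1 <= i < N.+1) delta N T i * e i t w.
pose Yg t w := \sum_(1 <= i < N.+1) gamma N T i * e i t w.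
have mY (a : nat -> R) t :
    measurable_fun setT (fun w => \sum_(1 <= i < N.+1) a i * e i t w).
  by apply: measurable_sum => i; apply: measurable_funM.
have vY (a : nat -> R) b k : mean_le P
    (fun w => win (fun t w => \sum_(1 <= i < N.+1) a i * e i t w) b k w ^+ 2)
    (S * (\sum_(1 <= i < N.+1) a i * a i) * k%:R).
  under eq_fun do rewrite win_lincomb.
  by have := mean_le_weighted N me e_indep e_mean e_var s2_le e_L4 a b k; apply.
have [H1 [H2 [mH1 mH2 mH0 HH]]] := process_bridge meta eta_var T0 t0T'.
have [D1 [Dd [_ mDd mD0 HD]]] := process_bridge (mY (delta N T)) (vY (delta N T)) T0 t0T'.
have [G1 [Gg [_ mGg mG0 HG]]] := process_bridge (mY (gamma N T)) (vY (gamma N T)) T0 t0T'.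
have [B [mB HB]] := square_term_bound me e_indep e_var s2_le e_L4 e_u4 u4_le
  T0 t0T' C4_gt0 N_gt0.
have [K [mK HK]] := cross_bridge_bound me e_indep e_var s2_le e_L4 e_u4 u4_le
  T0 t0T' C4_gt0 N_gt0.
rewrite -/lam in mB mK; rewrite -/rT in mH1.
rewrite -/(panel_dot delta delta N T) -/D2 in mDd mD0.
rewrite -/(panel_dot gamma gamma N T) -/G2 in mGg mG0.
pose h0 w := bridge T (fun t => win eta 1 t w) t0.
pose d0 w := bridge T (fun t => win Yd 1 t w) t0.
pose g0 w := bridge T (fun t => win Yg 1 t w) t0.
have sg0 : 0 <= `|Sg| by [].
(* The weights are rD, rD rT and rT because, up to constants, the means are Delta for [Dd], Delta T
   for [d0 ^+ 2] and T for [h0 ^+ 2]. *)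
exists (fun w => T%:R * `|Sg| * (1 + H2 w) + T%:R * (rD + rD^-1 * Dd w) +
    `|Sg| * (1 + h0 w ^+ 2) + (rD * rT + (rD * rT)^-1 * d0 w ^+ 2) +
    (2 * G2 * H1 w + 2 * B w) + G2 * (rT^-1 * h0 w ^+ 2 + rT * H2 w) +
    (rT^-1 * h0 w ^+ 2 + rT * Gg w) + (rT^-1 * g0 w ^+ 2 + rT * H2 w) + 2 * K w).
split.
  apply: (@mean_leW _ _ _ _ _
   (T%:R * `|Sg| * (1 + 82 * ce) + T%:R * (rD + rD^-1 * (82 * (S * D2))) +
    `|Sg| * (1 + 4 * ce * T%:R) + (rD * rT + (rD * rT)^-1 * (4 * (S * D2) * T%:R)) +
    (2 * G2 * (42 * ce * rT) + 2 * (4 * S * N%:R + 3 * lam)) +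
    G2 * (rT^-1 * (4 * ce * T%:R) + rT * (82 * ce)) +
    (rT^-1 * (4 * ce * T%:R) + rT * (82 * (S * G2))) +
    (rT^-1 * (4 * (S * G2) * T%:R) + rT * (82 * ce)) +
    2 * (4 * S * N%:R + 181 * lam))).
    have -> : rD^-1 * (82 * (S * D2)) = 82 * S * rD by rewrite DE; field; rewrite gt_eqF.
    have -> : (rD * rT)^-1 * (4 * (S * D2) * T%:R) = 4 * S * (rD * rT).
      by rewrite DE TE; field; rewrite !gt_eqF.
    have -> : rT^-1 * (4 * ce * T%:R) = 4 * ce * rT by rewrite TE; field; rewrite gt_eqF.
    have -> : rT^-1 * (4 * (S * G2) * T%:R) = 4 * S * G2 * rT.
      by rewrite TE; field; rewrite gt_eqF.
    have N0 : 0 <= N%:R :> R by [].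
    have a1 : `|Sg| <= T%:R * `|Sg| by rewrite ler_peMl.
    have a2 : rD * rT <= T%:R * rD.
      by rewrite mulrC ler_wpM2r ?(ltW rD0)// TE expr2 ler_peMl// ltW.
    have a3 : rT <= T%:R * rD.
      by apply: le_trans a2; rewrite ler_peMl// ltW.
    have a4 : T%:R <= T%:R * rD by rewrite ler_peMr// ltW.
    have a5 : 0 <= T%:R * rD by rewrite mulr_ge0// ltW.
    have a6 : 0 <= G2 * rT by rewrite mulr_ge0// ltW.
    have a7 : 0 <= T%:R * `|Sg| by rewrite mulr_ge0// ltW.
    have C40 := ltW C4_gt0.
    (* [lra] sees products as atoms, so every needed comparison multiplied by a constant is
       supplied. *)
    have b1 := ler_wpM2l S0 a2.
    have b2 := ler_wpM2l ce0 a3.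
    have b3 := ler_wpM2l ce0 a7.
    have b4 := ler_wpM2l C40 a7.
    have b5 := ler_wpM2l S0 a7.
    have c1 := ler_wpM2l C40 a5.
    have c3 := ler_wpM2l S0 a5.
    have c4 := ler_wpM2l ce0 a5.
    have d1 := ler_wpM2l C40 a6.
    have d2 := ler_wpM2l S0 a6.
    have d3 := ler_wpM2l ce0 a6.
    have f1 := ler_wpM2l C40 N0.
    have f2 := ler_wpM2l S0 N0.
    have f3 := ler_wpM2l ce0 N0.
    lra.
  have r1 : 0 <= rD^-1 by rewrite invr_ge0 ltW.
  have r2 : 0 <= (rD * rT)^-1 by rewrite invr_ge0 mulr_ge0// ltW.
  have r3 : 0 <= rT^-1 by rewrite invr_ge0 ltW.
  have mc (c : R) : 0 <= c -> mean_le P (fun=> c) c by exact: mean_le_cst.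
  have k2 : 0 <= 2 * G2 by rewrite mulr_ge0.
  have kT : 0 <= T%:R * `|Sg| by rewrite mulr_ge0.
  have rT0' := ltW rT0; have rD0' := ltW rD0.
  apply: mean_leD; last by apply: mean_leZ.
  apply: mean_leD; last by apply: mean_leD; apply: mean_leZ.
  apply: mean_leD; last by apply: mean_leD; apply: mean_leZ.
  apply: mean_leD.
    apply: mean_leD; last by apply: mean_leD; apply: mean_leZ.
    apply: mean_leD; last first.
      by apply: mean_leD; [apply: mc; rewrite mulr_ge0|exact: mean_leZ].
    apply: mean_leD; last by apply: mean_leZ => //; apply: mean_leD => //; exact: mc.
    apply: mean_leD; last first.
      by apply: mean_leZ => //; apply: mean_leD; [exact: mc|exact: mean_leZ].
    by apply: mean_leZ => //; apply: mean_leD => //; exact: mc.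
  by apply: mean_leZ => //; apply: mean_leD; exact: mean_leZ.
move=> w t tT; rewrite /criterion !cusum_panel_bridge//.
have [bg1 bg2 bg3] := bridge_jump_bounds (ltW x_gt0) (ltW y_gt0) tT t0T' T0 xt0 yt0.
have [hh1 hh2] := HH t w tT.
have [_ hd] := HD t w tT; have [_ hg] := HG t w tT.
have hB := HB t w tT; have hK := HK t w tT.
have [p1 _ _] := mH2; have [p2 _ _] := mDd; have [p3 _ _] := mGg.
have YE (a : nat -> R) u :
    bridge T (fun t => win (fun t w => \sum_(1 <= i < N.+1) a i * e i t w) 1 t w) u =
    \sum_(1 <= i < N.+1) a i * bridge T (fun t => win (e i) 1 t w) u.
  rewrite -bridge_sum; congr (bridge T _ u); apply/funext => v.
  exact: win_lincomb.
rewrite !YE in hd hg.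
have dE (a : nat -> R) : \sum_(1 <= i < N.+1) a i * bridge T (fun t => win (e i) 1 t w) t -
    \sum_(1 <= i < N.+1) a i * bridge T (fun t => win (e i) 1 t w) t0 =
    \sum_(1 <= i < N.+1) a i * (bridge T (fun t => win (e i) 1 t w) t -
      bridge T (fun t => win (e i) 1 t w) t0).
  by rewrite -sumrB; apply: eq_bigr => i _; rewrite -mulrBr.
rewrite !dE in hd hg.
have := @criterion_drop R N T (delta N T) (gamma N T)
  (fun i => bridge T (fun t => win (e i) 1 t w) t)
  (fun i => bridge T (fun t => win (e i) 1 t w) t0)
  (bridge T (jump R t0) t) (bridge T (jump R t0) t0)
  (bridge T (fun t => win eta 1 t w) t) (h0 w) (gap t t0)%:R ((x * y) ^+ 2)
  (H1 w) (H2 w) (Dd w) (Gg w) (B w) (K w) rD (rD * rT) rT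
  (ler0n _ _) rD0 (mulr_gt0 rD0 rT0) rT0 (p1 w) (p2 w) (p3 w) bg1 bg2 bg3
  hh1 hh2 hd hg hB hK.
move=> /le_trans; apply; apply: ler_wpM2l => //.
rewrite -/(panel_dot delta delta N T) -/(panel_dot delta gamma N T)
  -/(panel_dot gamma gamma N T) -/D2 -/Sg -/G2 -!YE -/(Yd) -/(Yg).
rewrite -/(d0 w) -/(g0 w).
rewrite le_eqVlt; apply/orP; left; apply/eqP; field.
by rewrite !gt_eqF.
Qed.

(** At a maximizer other than t0 the criterion difference is nonnegative and the gap positive, which
    forces [A w] up to the drift (x y)^2 Delta T. *)
Lemma mislocation_probability (th : Omega -> nat) :
  (forall w, is_argmax T (criterion w) (th w)) ->
  measurable [set w | th w != t0] ->
  (P [set w | th w != t0] <= ((370 * (1 + ce + S + C4) *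
      (T%:R * `|Sg| + T%:R * Num.sqrt D2 + G2 * Num.sqrt T%:R + N%:R)) /
      ((x * y) ^+ 2 * D2 * T%:R))%:E)%E.
Proof.
move=> ham mA; have [A [HA drop]] := criterion_drop_bound.
apply: (mean_le_markov HA) => //.
  apply: mulr_gt0; last by rewrite ltr0n; lia.
  apply: mulr_gt0; last exact: lt_le_trans D2_ge1.
  by rewrite exprn_gt0// mulr_gt0.
move=> w /= tht0; have [tT tmax] := ham w.
have := tmax t0 t0T; have := drop w (th w) _.
have tT' : (th w <= T)%N by lia.
move=> /(_ tT') h1 h2.
have g0 : 0 < (gap (th w) t0)%:R :> R.
  by rewrite ltr0n /gap; move/eqP: tht0; lia.
rewrite -subr_ge0 -(pmulr_rge0 _ g0); apply: le_trans h1.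
by rewrite subr_ge0.
Qed.


End mislocation.

(** * Moment bounds from the assumptions *)

Section moments.
Context d (Omega : measurableType d) (R : realType) (P : probability Omega R).

Lemma integ_lty (f : Omega -> R) : measurable_fun setT f ->
  (forall w, 0 <= f w) -> (\int[P]_w (f w)%:E < +oo)%E -> integ P f.
Proof.
move=> mf f0 fy; apply/integrableP; split; first exact/measurable_EFinP.
by under eq_integral do rewrite /= ger0_norm//.
Qed.

Lemma mean_le_int (f : Omega -> R) c : measurable_fun setT f ->
  (forall w, 0 <= f w) -> (\int[P]_w (f w)%:E <= c%:E)%E -> mean_le P f c.
Proof.
move=> mf f0 fc; have fi : integ P f.
  by apply: integ_lty => //; exact: le_lt_trans fc (ltry _).
by split=> //; rewrite -lee_fin -EFin_Ex.
Qed.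

Lemma measurable_partial_sum (X : int -> Omega -> R) t :
  (forall s, measurable_fun setT (X s)) -> measurable_fun setT (partial_sum X t).
Proof. by move=> mX; apply: measurable_sum => s. Qed.

Lemma abs_moment2E (X : int -> Omega -> R) t :
  abs_moment P X 2 t = (\int[P]_w (partial_sum X t w ^+ 2)%:E)%E.
Proof.
rewrite /abs_moment unlock; apply: eq_integral => w _.
by rewrite powR_mulrn ?normr_ge0// real_normK ?num_real.
Qed.

(** With v = z^2/t this is v^2 <= 1 + v^(k/2), true because k/2 > 2. *)
Lemma fourth_power_le (t k z : R) : 0 < t -> 4 < k ->
  z ^+ 4 / t ^+ 2 <= 1 + (t `^ (k / 2))^-1 * `|z| `^ k.
Proof.
move=> t0 k4; set v := z ^+ 2 / t.
have v0 : 0 <= v by rewrite divr_ge0 ?sqr_ge0// ltW.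
have -> : z ^+ 4 / t ^+ 2 = v ^+ 2 by rewrite /v expr_div_n -exprM.
have -> : (t `^ (k / 2))^-1 * `|z| `^ k = v `^ (k / 2).
  have -> : `|z| `^ k = (z ^+ 2) `^ (k / 2).
    have {1}-> : k = 2 * (k / 2) by field.
    by rewrite powRrM powR_mulrn ?normr_ge0// real_normK ?num_real.
  rewrite /v powRM ?sqr_ge0 ?invr_ge0 ?(ltW t0)// mulrC; congr (_ * _).
  have tp : t `^ (k / 2) != 0 by rewrite gt_eqF// powR_gt0.
  apply: (mulfI tp); rewrite mulfV// -powRM ?invr_ge0 ?(ltW t0)//.
  by rewrite mulfV ?powR1// gt_eqF.
have [v1|v1] := leP v 1.
  by rewrite ler_wpDr ?powR_ge0// expr_le1.
rewrite ler_wpDl// -powR_mulrn//; apply: ler_powR; first exact: ltW.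
by rewrite ler_pdivlMr//; lra.
Qed.

Lemma eq_window_lengths (X : int -> Omega -> R) (c : R) a k :
  (forall t, measurable_fun setT (X t)) -> stationary P X ->
  mean_le P (fun w => partial_sum X k w ^+ 2) c ->
  mean_le P (fun w => win X a k w ^+ 2) c.
Proof.
have -> : partial_sum X k = win X 1 k.
  by apply/funext => w; exact: partial_sum_win.
move=> mX sX [_ i1 E1].
have mp : measurable_fun setT (fun x : R => x ^+ 2) by exact: measurable_funX.
split; first by move=> w; exact: sqr_ge0.
  by have [_ +] := stationary_win (P := P) 1 a k mX sX mp; exact.
by have := stationary_Ex (P := P) a 1 k mX sX mp => /= ->.
Qed.

(* A bound for long windows passes to short ones, a window of length k being
   the difference of windows of lengths n + k and n. *)
Lemma short_windows (X : int -> Omega -> R) (n : nat) :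
  (forall t, measurable_fun setT (X t)) -> stationary P X -> (0 < n)%N ->
  (forall k, (n <= k)%N -> mean_le P (fun w => partial_sum X k w ^+ 2) (2 * k%:R)) ->
  forall a k, mean_le P (fun w => win X a k w ^+ 2) (12 * n%:R * k%:R).
Proof.
move=> mX sX n0 H a k.
have [->|k0] := posnP k.
  rewrite mulr0 (_ : (fun _ => _) = cst 0); first exact: mean_le_cst.
  by apply/funext => w; rewrite /win big_geq// expr0n.
have L b m : (n <= m)%N -> mean_le P (fun w => win X b m w ^+ 2) (2 * m%:R).
  by move=> nm; apply: eq_window_lengths => //; exact: H.
have h1 := mean_leD (mean_leZ (ler0n R 2) (L a (k + n)%N (leq_addl _ _)))
  (mean_leZ (ler0n R 2) (L (a + k%:Z) n (leqnn _))).
(* 4 (k + n) + 4 n = 4 k + 8 n is at most 12 n k since n and k are at least 1. *)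
have h2 : 2 * (2 * (k + n)%:R) + 2 * (2 * n%:R) <= 12 * n%:R * k%:R :> R.
  have : 1 <= n%:R :> R by rewrite ler1n.
  have : 1 <= k%:R :> R by rewrite ler1n.
  by rewrite natrD; nra.
apply: mean_leW h2 (mean_le_dom _ _ h1).
  by apply: measurable_funX; exact: measurable_win.
move=> w; rewrite sqr_ge0 /= win_cat.
move: (win X a k w) (win X _ n w) => u v.
by have := sqr_ge0 (u + 2 * v); nra.
Qed.

End moments.

Section hypotheses_moments.
Context d (Omega : measurableType d) (R : realType) (P : probability Omega R).

Lemma le_bigmaxe_nat (F : nat -> \bar R) n i : (1 <= i <= n)%N ->
  (F i <= \big[maxe/0]_(1 <= j < n.+1) F j)%E.
Proof.
move=> i1n; apply: (@le_bigmax_seq _ _ _ _ _ i xpredT F) => //.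
by rewrite mem_index_iota; lia.
Qed.

(* The error processes do not depend on N and T, so the maximum over i <= N and
   t <= T can only vanish in the limit if every term of it is zero. *)
Lemma exact_variance (X : nat -> int -> Omega -> R) (sigma : nat -> R) i t :
  (\big[maxe/0]_(1 <= i < NT.1.+1) \big[maxe/0]_(1 <= t < NT.2.+1)
     `| (t%:R^-1)%:E * abs_moment P (X i) 2 t - (sigma i ^+ 2)%:E |)%E
     @[NT --> min_oo] --> 0%E ->
  (1 <= i)%N -> (1 <= t)%N ->
  abs_moment P (X i) 2 t = (sigma i ^+ 2 * t%:R)%:E.
Proof.
move=> hU i1 t1.
set F := fun i t => (`| (t%:R^-1)%:E * abs_moment P (X i) 2 t - (sigma i ^+ 2)%:E |)%E.
have F0 : (F i t <= 0)%E.
  apply: (cvge_to_ge hU); apply/min_ooP; exists (maxn i t) => N T NT /=.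
  have NT' : (maxn i t <= N)%N && (maxn i t <= T)%N by rewrite -leq_min.
  have h1 := @le_bigmaxe_nat (F i) T t.
  have h2 := @le_bigmaxe_nat (fun i => \big[maxe/0]_(1 <= t < T.+1) F i t)%E N i.
  by apply: (le_trans (h1 _) (h2 _)); lia.
have E : ((t%:R^-1)%:E * abs_moment P (X i) 2 t = (sigma i ^+ 2)%:E)%E.
  move: F0; rewrite /F; case: (_ * abs_moment _ _ _ _)%E => [r| |]//=.
  by rewrite lee_fin normr_le0 subr_eq0 => /eqP ->.
have t0 : t%:R != 0 :> R by rewrite pnatr_eq0; lia.
have : ((t%:R)%:E * ((t%:R^-1)%:E * abs_moment P (X i) 2 t) =
   (t%:R)%:E * (sigma i ^+ 2)%:E)%E by rewrite E.
by rewrite muleA -EFinM mulfV// mul1e -EFinM mulrC.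
Qed.

(** The assumption bounds the sum of squares of the normalised moments. This makes each of them
    finite and, by 1 + y <= 2 + y^2, bounds the sum of fourth moments with constant 2 + |C|. *)
Lemma fourth_moments (X : nat -> int -> Omega -> R) (kappa : R) :
  (forall i t, measurable_fun setT (X i t)) -> 4 < kappa ->
  (exists C : R, \forall NT \near min_oo,
     ((NT.1%:R^-1)%:E * \big[maxe/0]_(1 <= t < NT.2.+1)
        (\sum_(1 <= i < NT.1.+1)
          (((t%:R `^ (kappa / 2))^-1)%:E * abs_moment P (X i) kappa t) ^+ 2)%E
        <= C%:E)%E) ->
  exists C4 : R, 0 < C4 /\ exists n0, forall N, (n0 <= N)%N -> forall t, (1 <= t)%N ->
    (forall i, (1 <= i <= N)%N -> integ P (fun w => partial_sum (X i) t w ^+ 4)) /\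
    \sum_(1 <= i < N.+1) Ex P (fun w => partial_sum (X i) t w ^+ 4) <=
      C4 * N%:R * t%:R ^+ 2.
Proof.
move=> mX k4 [C /min_ooP[n0 H]]; exists (2 + `|C|); split.
  by rewrite ltr_wpDr.
exists (maxn 1 n0) => N nN t t1.
have N0 : 0 < N%:R :> R by rewrite ltr0n; lia.
have t0 : 0 < t%:R :> R by rewrite ltr0n.
(* The bound is uniform in T, so T = max(n0, t) may be chosen for each t; no upper restriction on t
   remains. *)
have nNT : (n0 <= minn N (maxn n0 t))%N by rewrite leq_min; lia.
have := H _ _ nNT; rewrite /= lee_pdivrMl//.
pose Y i : \bar R := (((t%:R `^ (kappa / 2))^-1)%:E * abs_moment P (X i) kappa t)%E.
have tT : (1 <= t <= maxn n0 t)%N by lia.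
move=> /(le_trans (le_bigmaxe_nat
  (fun t => \sum_(1 <= i < N.+1) (((t%:R `^ (kappa / 2))^-1)%:E *
     abs_moment P (X i) kappa t) ^+ 2)%E tT)).
rewrite -/(Y _) -EFinM => HY.
have c0 : 0 <= (t%:R `^ (kappa / 2))^-1 :> R by rewrite invr_ge0 powR_ge0.
have M0 i : (0 <= abs_moment P (X i) kappa t)%E.
  by apply: expectation_ge0 => w; exact: powR_ge0.
have Y0 i : (0 <= Y i)%E by apply: mule_ge0 => //; rewrite lee_fin.
have Yfin i : (1 <= i <= N)%N -> Y i \is a fin_num.
  move=> iN; rewrite ge0_fin_numE//.
  have : (Y i ^+ 2 <= (N%:R * C)%:E)%E.
    apply: le_trans HY; rewrite (bigD1_seq i) ?iota_uniq//=; last first.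
      by rewrite mem_index_iota; lia.
    rewrite leeDl//; apply: sume_ge0 => j _.
    exact: mule_ge0 (Y0 j) (Y0 j).
  by have := Y0 i; case: (Y i) => [r| |]//= _; rewrite ?ltry.
have mps i : measurable_fun setT (partial_sum (X i) t) by exact: measurable_partial_sum.
have mle i : (1 <= i <= N)%N -> mean_le P (fun w => partial_sum (X i) t w ^+ 4)
    (t%:R ^+ 2 * (2 + fine (Y i) ^+ 2)).
  move=> iN.
  have h : mean_le P (fun w => partial_sum (X i) t w ^+ 4 / t%:R ^+ 2) (1 + fine (Y i)).
    apply: mean_le_int.
    - by apply: measurable_funM => //; exact: measurable_funX.
    - by move=> w; rewrite divr_ge0 ?exprn_even_ge0.
    rewrite EFinD fineK ?Yfin//.
    have mpow : measurable_fun setT (fun w => `|partial_sum (X i) t w| `^ kappa).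
      by apply: (measurableT_comp (measurable_powR _)); exact: measurableT_comp.
    rewrite /Y /abs_moment unlock -ge0_integralZl_EFin//;
      [|exact/measurable_EFinP].
    have -> : (1%E = \int[P]_w (1%R)%:E :> \bar R)%E.
      by rewrite integral_cst// mul1e; have /= -> := probability_setT P.
    rewrite -ge0_integralD//;
      [|by apply: emeasurable_funM => //; exact/measurable_EFinP].
    apply: ge0_le_integral => //=.
    - by move=> w _; rewrite lee_fin divr_ge0 ?exprn_even_ge0.
    - by apply/measurable_EFinP; apply: measurable_funM => //; exact: measurable_funX.
    - by apply: emeasurable_funD => //; apply: emeasurable_funM => //; exact/measurable_EFinP.
    - by move=> w _; rewrite -EFinM -EFinD lee_fin; exact: fourth_power_le.
  have t20 : 0 <= t%:R ^+ 2 :> R by exact: exprn_ge0.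
  have := mean_leZ t20 h.
  have -> : (fun w => t%:R ^+ 2 * (partial_sum (X i) t w ^+ 4 / t%:R ^+ 2)) =
      (fun w => partial_sum (X i) t w ^+ 4).
    by apply/funext => w; rewrite mulrC divfK// expf_neq0// gt_eqF.
  apply: mean_leW; rewrite ler_wpM2l//.
  by have := sqr_ge0 (2 * fine (Y i) - 1); lra.
split; first by move=> i /mle[].
apply: (@le_trans _ _ (\sum_(1 <= i < N.+1) t%:R ^+ 2 * (2 + fine (Y i) ^+ 2))).
  by apply: ler_sum_nat => i iN; have [] := mle i iN.
rewrite -mulr_sumr big_split /= sumr_const_nat subn1 /= mulrC.
apply: ler_wpM2r; first exact: exprn_ge0.
rewrite mulrDl -[_ *+ _]mulr_natr lerD2l.
apply: (@le_trans _ _ (N%:R * C)); last first.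
  by rewrite mulrC ler_wpM2r ?ler_norm// ltW.
rewrite -lee_fin; apply: le_trans HY; rewrite -sumEFin.
rewrite big_nat [leRHS]big_nat; apply: lee_sum => i iN.
by rewrite EFin_expe fineK// Yfin.
Qed.

(** The o(t) with tolerance 1 gives second moments at most 2t for long sums; finiteness is part of
    the convergence to a real limit. Stationarity then reaches windows of every length. *)
Lemma factor_variance (X : int -> Omega -> R) :
  (forall t, measurable_fun setT (X t)) -> stationary P X ->
  ((t%:R^-1)%:E * ('E_P[fun w => (partial_sum X t w ^+ 2)%R] - t%:R%:E))%E
    @[t --> \oo] --> 0%E ->
  exists ce : R, forall a k, mean_le P (fun w => win X a k w ^+ 2) (ce * k%:R).
Proof.
move=> mX sX /fine_cvgP[hfin hlim].
have : \forall t \near \oo, mean_le P (fun w => partial_sum X t w ^+ 2) (2 * t%:R).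
  have h1 := cvgr0_norm_le _ hlim _ ltr01.
  near=> t.
  have t0 : 0 < t%:R :> R by rewrite ltr0n; near: t; exists 1%N.
  have mps : measurable_fun setT (partial_sum X t) by exact: measurable_partial_sum.
  apply: mean_le_int; [exact: measurable_funX|by move=> w; exact: sqr_ge0|].
  have h2 : (`|fine ((t%:R^-1)%:E * ('E_P[fun w => (partial_sum X t w ^+ 2)%R] -
    t%:R%:E))%E| <= 1) by near: t; exact: h1.
  have h3 : ((t%:R^-1)%:E * ('E_P[fun w => (partial_sum X t w ^+ 2)%R] -
    t%:R%:E))%E \is a fin_num by near: t; exact: hfin.
  have -> : (\int[P]_w (partial_sum X t w ^+ 2)%:E)%E =
    ('E_P[fun w => (partial_sum X t w ^+ 2)%R])%E by rewrite unlock.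
  have E0 : (0 <= 'E_P[fun w => (partial_sum X t w ^+ 2)%R])%E.
    by apply: expectation_ge0 => w; exact: sqr_ge0.
  move: h2 h3 E0; case: ('E_P[_])%E => [r| |]//=.
    move=> h _ r0; rewrite lee_fin.
    have : t%:R^-1 * (r - t%:R) <= 1 by apply: le_trans h; exact: ler_norm.
    by rewrite ler_pdivrMl//; lra.
  by rewrite mulry gtr0_sg ?invr_gt0// mul1e.
move=> [n _ nH]; exists (12 * n.+1%:R).
apply: short_windows => //= k nk; apply: nH => /=; lia.
Unshelve. all: by end_near.
Qed.

End hypotheses_moments.

(** * Rates and conclusion *)

Lemma change_time_bounds (R : realType) (t0 : nat -> nat) (theta : R) :
  0 < theta < 1 -> (forall T : nat, (t0 T)%:Z = Num.floor (T%:R * theta)) ->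
  exists T1, forall T, (T1 <= T)%N ->
    [/\ (1 <= t0 T < T)%N, theta / 2 * T%:R <= (t0 T)%:R &
        (1 - theta) * T%:R <= T%:R - (t0 T)%:R :> R].
Proof.
(* The threshold ensures T theta >= 2, so that the floor, larger than T theta - 1, is at least T
   theta / 2. *)
move=> /andP[th0 th1] ht0; exists (Num.trunc (2 / theta)).+1 => T TT.
have Tth : 2 <= T%:R * theta.
  rewrite -ler_pdivrMr//; apply: le_trans (ltW (truncnS_gt _)) _.
  by rewrite ler_nat.
have /andP[] := floor_itv (T%:R * theta); rewrite -ht0 intrD -pmulrn => f1 f2.
have h1 : theta / 2 * T%:R <= (t0 T)%:R by lra.
have T0 : 0 < T%:R :> R by rewrite ltr0n; lia.
split=> //; last by lra.
apply/andP; split.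
  by rewrite -(ltr0n R); apply: lt_le_trans h1; rewrite mulr_gt0// divr_gt0.
by rewrite -(ltr_nat R); apply: le_lt_trans f1 _; rewrite gtr_pMr.
Qed.

(** Term by term division by D T. The loading term becomes G / sqrt(T D) times 1 / sqrt D, and the
    last factor is dropped as D >= 1. *)
Lemma rate_bound (R : realType) (T N D G S C q : R) :
  1 <= T -> 0 < N -> 1 <= D -> 0 <= G -> 0 <= C -> 0 < q ->
  C * (T * `|S| + T * Num.sqrt D + G * Num.sqrt T + N) / (q * D * T) <=
  C / q * (`|S / D| + (Num.sqrt D)^-1 + `|G / Num.sqrt (T * D)| + (T * D / N)^-1).
Proof.
move=> T1 N0 D1 G0 C0 q0.
have T0 : 0 < T by exact: lt_le_trans T1.
have D0 : 0 < D by exact: lt_le_trans D1.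
have rD1 : 1 <= Num.sqrt D by rewrite -[leLHS]sqrtr1 ler_sqrt// ltW.
have GTD : 0 <= G / (Num.sqrt T * Num.sqrt D) by rewrite divr_ge0// mulr_ge0.
rewrite sqrtrM ?(ltW T0)// normf_div (gtr0_norm D0) (ger0_norm GTD).
have sT : T = Num.sqrt T ^+ 2 by rewrite sqr_sqrtr// ltW.
have sD : D = Num.sqrt D ^+ 2 by rewrite sqr_sqrtr// ltW.
have rT0 : 0 < Num.sqrt T by rewrite sqrtr_gt0.
have rD0 : 0 < Num.sqrt D by rewrite sqrtr_gt0.
(* Stated in a = sqrt T and b = sqrt D, where the identity is rational and within reach of
   [field]. *)
have key a b s : 0 < a -> 0 < b ->
    C * (a ^+ 2 * s + a ^+ 2 * b + G * a + N) / (q * b ^+ 2 * a ^+ 2) =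
    C / q * (s / b ^+ 2 + b^-1 + G / (a * b) * b^-1 + (a ^+ 2 * b ^+ 2 / N)^-1).
  by move=> a0 b0; field; rewrite !gt_eqF.
have := key _ _ `|S| rT0 rD0; rewrite -sT -sD => ->.
apply: ler_wpM2l; first by rewrite divr_ge0// ltW.
by rewrite lerD2r lerD2l ler_piMr// invf_le1.
Qed.

Lemma rate_cvg0 (R : realType) (I : Type) (F : set_system I) (FF : Filter F)
    (D q g s : I -> R) :
  D x @[x --> F] --> +oo -> q x @[x --> F] --> +oo ->
  g x @[x --> F] --> (0 : R) -> s x @[x --> F] --> (0 : R) ->
  (`|s x| + (Num.sqrt (D x))^-1 + `|g x| + (q x)^-1) @[x --> F] --> (0 : R).
Proof.
move=> hD hq hg hs.
have inv (u : I -> R) : u x @[x --> F] --> +oo -> (u x)^-1 @[x --> F] --> (0 : R).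
  move=> hu; apply: (gtr0_cvgV0 _).2 => //.
  by move/cvgryPgt : hu; exact.
have -> : (0 : R) = `|0 : R| + Num.sqrt 0 + `|0 : R| + 0 by rewrite normr0 sqrtr0 !addr0.
apply: cvgD; last exact: inv.
apply: cvgD; last exact: cvg_norm.
apply: cvgD; first exact: cvg_norm.
(* Moving the inverse inside reduces to continuity of the root at 0; for negative arguments both
   sides are 0. *)
have -> : (fun x => (Num.sqrt (D x))^-1) = (fun x => Num.sqrt ((D x)^-1)).
  apply/funext => x; have [D0|D0] := leP 0 (D x); first by rewrite sqrtrV.
  by rewrite !ler0_sqrtr ?invr0 ?invr_le0// ltW.
apply: continuous_cvg; first exact: sqrt_continuous.
exact: inv.
Qed.

Theorem theorem2p1 (R : realType) (d : measure_display)
    (Omega : measurableType d) (P : probability Omega R)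
    (mu : nat -> R) (delta gamma : nat -> nat -> nat -> R)
    (eta : int -> {RV P >-> R}) (e : nat -> int -> {RV P >-> R})
    (t0 : nat -> nat) (theta : R) (sigma : nat -> R)
    (C1 C2 kappa kappabar : R)
    (that : nat -> nat -> {RV P >-> nat})
    (* the estimator; ties between maximizers are broken arbitrarily *)
    (hthat : forall N T : nat, (1 <= N)%N -> (2 <= T)%N -> forall w : Omega,
      is_argmax T
        (cusum_criterion (panel mu delta gamma eta e (t0 T) N T) N T w)
        (that N T w))
    (he_mean : forall (i : nat) (t : int), (1 <= i)%N -> ('E_P[e i t] = 0)%E)
    (* (1) *)
    (he_indep : independent_sequences P e)
    (heta_stat : stationary P eta)
    (he_stat : forall i : nat, (1 <= i)%N -> stationary P (e i))
    (* (2) *)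
    (htheta : 0 < theta < 1)
    (ht0 : forall T : nat, (t0 T)%:Z = Num.floor (T%:R * theta))
    (* (3) *)
    (hC1 : 0 < C1) (hC12 : C1 <= C2)
    (hsigma : forall i : nat, (1 <= i)%N -> C1 <= sigma i <= C2)
    (hU2 : (\big[maxe/0]_(1 <= i < NT.1.+1) \big[maxe/0]_(1 <= t < NT.2.+1)
              `| (t%:R^-1)%:E * abs_moment P (e i) 2 t - (sigma i ^+ 2)%:E |)%E
           @[NT --> min_oo] --> 0%E)
    (hkappa : 4 < kappa)
    (hUkappa : exists C : R, \forall NT \near min_oo,
       ((NT.1%:R^-1)%:E * \big[maxe/0]_(1 <= t < NT.2.+1)
          (\sum_(1 <= i < NT.1.+1)
            (((t%:R `^ (kappa / 2))^-1)%:E * abs_moment P (e i) kappa t) ^+ 2)%E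
        <= C%:E)%E)
    (* (4) *)
    (hkappabar : 2 < kappabar)
    (heta_mean : forall t : int, ('E_P[eta t] = 0)%E)
    (heta_var : ((t%:R^-1)%:E *
                 ('E_P[fun w => (partial_sum eta t w ^+ 2)%R] - t%:R%:E))%E
                @[t --> \oo] --> 0%E)
    (heta_mom : exists C : R, \forall t \near \oo,
       (abs_moment P eta kappabar t <= (C * t%:R `^ (kappabar / 2))%:E)%E)
    (* (5) *)
    (hDelta_N : NT.2%:R * panel_dot delta delta NT.1 NT.2 / NT.1%:R
                @[NT --> min_oo] --> +oo)
    (hGamma : panel_dot gamma gamma NT.1 NT.2 /
                Num.sqrt (NT.2%:R * panel_dot delta delta NT.1 NT.2)
              @[NT --> min_oo] --> (0 : R))
    (* (6) *)
    (hDelta : panel_dot delta delta NT.1 NT.2 @[NT --> min_oo] --> +oo)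
    (hSigma : panel_dot delta gamma NT.1 NT.2 / panel_dot delta delta NT.1 NT.2
              @[NT --> min_oo] --> (0 : R)) :
  P [set w | that NT.1 NT.2 w = t0 NT.2] @[NT --> min_oo] --> 1%E.
Proof.
have meta t : measurable_fun setT (eta t : Omega -> R) by [].
have me i t : measurable_fun setT (e i t : Omega -> R) by [].
have [ce eta_var] := factor_variance meta heta_stat heta_var.
have [C4 [C4_gt0 [n4 H4]]] := fourth_moments me hkappa hUkappa.
have [T1 HT1] := change_time_bounds htheta ht0.
have e_mean i t : (1 <= i)%N -> Ex P (e i t) = 0.
  by move=> i1; have := he_mean i t i1; rewrite unlock /Ex /Rintegral => ->.
have s2_le i : (1 <= i)%N -> 0 <= sigma i ^+ 2 <= C2 ^+ 2.
  move=> /hsigma /andP[c1 c2]; rewrite sqr_ge0 /=.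
  have C10 := ltW hC1; have s0 := le_trans C10 c1.
  by rewrite lerXn2r ?nnegrE// (le_trans s0).
have sqrm n : measurable_fun setT (fun z : R => z ^+ n) by exact: measurable_funX.
have win0 i a w : win (e i) a 0 w = 0 by rewrite /win big_geq.
have psE i k : partial_sum (e i) k = win (e i) 1 k.
  by apply/funext => w; exact: partial_sum_win.
have e_var2 i a k : (1 <= i)%N -> integ P (fun w => win (e i) a k w ^+ 2) /\
    Ex P (fun w => win (e i) a k w ^+ 2) = sigma i ^+ 2 * k%:R.
  move=> i1; have [->|k0] := posnP k.
    have -> : (fun w => win (e i) a 0 w ^+ 2) = cst 0.
      by apply/funext => w; rewrite win0 expr0n.
    by rewrite mulr0 Ex_cst; split => //; exact: integ_cst.
  have := exact_variance hU2 i1 k0; rewrite abs_moment2E psE => E.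
  have i2 : integ P (fun w => win (e i) 1 k w ^+ 2).
    apply: integ_lty => [||]; last by rewrite E ltry.
    - by apply: measurable_funX; exact: measurable_win.
    - by move=> w; exact: sqr_ge0.
  have [_ h] := stationary_win (P := P) 1 a k (me i) (he_stat i i1) (sqrm 2%N).
  split; first exact: h.
  have /= -> := stationary_Ex (P := P) a 1 k (me i) (he_stat i i1) (sqrm 2%N).
  by apply: EFin_inj; rewrite -EFin_Ex.
have e_L4 i a k : (1 <= i)%N -> L2 P (fun w => win (e i) a k w ^+ 2).
  move=> i1; split; first by apply: measurable_funX; exact: measurable_win.
  have -> : (fun w => (win (e i) a k w ^+ 2) ^+ 2) = (fun w => win (e i) a k w ^+ 4).
    by apply/funext => w; rewrite -exprM.
  have [->|k0] := posnP k.
    have -> : (fun w => win (e i) a 0 w ^+ 4) = cst 0.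
      by apply/funext => w; rewrite win0 expr0n.
    exact: integ_cst.
  (* The law of panel i does not depend on N, so any sample size that is large enough and contains
     panel i gives its fourth moment. *)
  have [h4 _] := H4 (maxn n4 i) (leq_maxl _ _) k k0.
  have [_ h] := stationary_win (P := P) 1 a k (me i) (he_stat i i1) (sqrm 4%N).
  by apply: h; rewrite -psE; apply: h4; rewrite i1 leq_maxr.
pose u4 i k := Ex P (fun w => win (e i) 1 k w ^+ 4).
have e_u4 i a k : (1 <= i)%N -> Ex P (fun w => win (e i) a k w ^+ 4) = u4 i k.
  move=> i1.
  by have /= -> := stationary_Ex (P := P) a 1 k (me i) (he_stat i i1) (sqrm 4%N).
have u4_le N k : (n4 <= N)%N ->
    \sum_(1 <= i < N.+1) u4 i k <= C4 * N%:R * k%:R ^+ 2.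
  move=> nN; have [->|k0] := posnP k.
    rewrite expr0n mulr0 big1// => i _.
    have -> : u4 i 0%N = Ex P (cst 0); last by rewrite Ex_cst.
    by congr (Ex P _); apply/funext => w; rewrite win0 expr0n.
  have [_] := H4 N nN k k0.
  by under eq_bigr do rewrite psE.
pose D NT := panel_dot delta delta NT.1 NT.2.
pose S NT := panel_dot delta gamma NT.1 NT.2.
pose G NT := panel_dot gamma gamma NT.1 NT.2.
have /andP[th0 th1] := htheta.
set x := theta / 2; set y := 1 - theta.
have x0 : 0 < x by rewrite divr_gt0.
have y0 : 0 < y by rewrite subr_gt0.
pose K := 370 * (1 + ce + C2 ^+ 2 + C4) / (x * y) ^+ 2.
pose r (NT : nat * nat) := `|S NT / D NT| + (Num.sqrt (D NT))^-1 +
  `|G NT / Num.sqrt (NT.2%:R * D NT)| + (NT.2%:R * D NT / NT.1%:R)^-1.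
have r0 : r NT @[NT --> min_oo] --> (0 : R) by exact: rate_cvg0.
have ce0 : 0 <= ce.
  have [f0 _ fc] := eta_var 0 1%N; rewrite -(mulr1 ce); apply: le_trans fc.
  exact: Ex_ge0.
have D1 : \forall NT \near min_oo, 1 <= D NT by move/cvgryPge : hDelta; exact.
(* The probability lies between 1 - K r and 1, where r collects the four vanishing rates. *)
apply: (@squeeze_cvge _ _ _ _ (fun NT => (1 - K * r NT)%:E) _ (fun=> 1%E)); last 2 first.
- apply/fine_cvgP; split; first exact: nearW.
  rewrite -[X in _ --> X](subr0 1) -[X in _ --> _ - X](mulr0 K).
  by apply: cvgB; [exact: cvg_cst|exact: cvgMr].
- exact: cvg_cst.
move/min_ooP : D1 => [n1 D1]; apply/min_ooP.
exists (maxn (maxn 2 n1) (maxn n4 T1)) => N T; rewrite leq_min !geq_max /=.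
move=> /andP[/andP[/andP[N2 n1N] /andP[n4N _]] /andP[/andP[T2 n1T] /andP[_ T1T]]].
have mE : measurable [set w | that N T w = t0 T].
  by have := measurable_funPT (that N T) measurableT [set t0 T] I; rewrite setTI.
rewrite probability_le1// andbT.
have [t0T xt yt] := HT1 T T1T.
have D1' : 1 <= D (N, T) by apply: D1; rewrite leq_min n1N.
have N0 : (0 < N)%N := ltnW N2.
have CE : [set w | that N T w != t0 T] = ~` [set w | that N T w = t0 T].
  by apply/seteqP; split=> w /= /eqP.
have mA : measurable [set w | that N T w != t0 T].
  by rewrite CE; exact: measurableC.
have := mislocation_probability me he_indep e_mean
  (fun i a k i1 => (e_var2 i a k i1).2) s2_le e_L4 e_u4
  (fun k => u4_le N k n4N) C4_gt0 N0 meta eta_var x0 y0 t0T xt yt D1'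
  (hthat N T N0 T2) mA.
have rb : 370 * (1 + ce + C2 ^+ 2 + C4) *
    (T%:R * `|S (N, T)| + T%:R * Num.sqrt (D (N, T)) +
      G (N, T) * Num.sqrt T%:R + N%:R) / ((x * y) ^+ 2 * D (N, T) * T%:R) <=
    K * r (N, T).
  apply: rate_bound => //.
  - by rewrite ler1n ltnW.
  - by rewrite ltr0n.
  - by apply: sumr_ge0 => i _; rewrite -expr2 sqr_ge0.
  - by rewrite mulr_ge0// !addr_ge0 ?sqr_ge0// ltW.
  - by rewrite exprn_gt0// mulr_gt0.
rewrite CE => h.
have rb' : (P (~` [set w | that N T w = t0 T]) <= (K * r (N, T))%:E)%E.
  by apply: (le_trans h); rewrite lee_fin.
move: rb'; rewrite probability_setC// -(@fineK _ (P [set w | that N T w = t0 T])).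
  by rewrite -EFinB !lee_fin; lra.
exact: fin_num_measure.
Qed.
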